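(* Let $\mathcal{C}\subseteq\mathcal{W}_\Gamma\times\mathcal{W}_\Gamma$ be a closed set. The following are equivalent: (1) the map $\mathcal{C}\to\mathcal{W}_\Gamma$, $(\mathfrak{a},\mathfrak{b})\mapsto\mathfrak{a}\times\mathfrak{b}$, is continuous; (2) for every finite $S\subseteq\Gamma$, $k\in\mathbb{N}^+$ and $\epsilon>0$ there is $N\in\mathbb{N}^+$ such that $N_{S,k}(\mathfrak{a},\mathfrak{b},\epsilon)\le N$ for all $(\mathfrak{a},\mathfrak{b})\in\mathcal{C}$.
   Context: $\Gamma$ is a countably infinite group; p.m.p. actions are measure-preserving actions on standard probability spaces. Each $k\in\mathbb{N}^+$ is identified with $\{0,\dots,k-1\}$; $\mathrm{Meas}_k(X,\mu)$ is the set of measurable maps $X\to k$. For finite $S\subseteq\Gamma$, $M^\alpha_{S,k}(f)(\gamma,i,j)=\mu(\{x: f(x)=i, f(\gamma\cdot x)=j\})$ and $C^\alpha_{S,k}$ is the closure in $\mathbb{I}_{S,k}=[0,1]^{S\times k\times k}$ of $\{M^\alpha_{S,k}(f)\}$; $\mathrm{dist}_\infty$ is the sup-metric. $\alpha\preceq\beta$ iff $C^\alpha_{S,k}\subseteq C^\beta_{S,k}$ for all $S,k$; $\alpha\simeq\beta$ iff both directions; $[\alpha]=(C^\alpha_{S,k})_{S,k}$. $\mathcal{W}_\Gamma$ is the set of classes of actions on atomless spaces, topologized as a subspace of $\prod_{S,k}\mathcal{K}(\mathbb{I}_{S,k})$ (nonempty compact subsets with the Hausdorff metric induced by $\mathrm{dist}_\infty$);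 $\mathcal{W}_\Gamma$ is compact metrizable. $[\alpha]\times[\beta]:=[\alpha\times\beta]$, with $\alpha\times\beta$ the diagonal product action. An $N$-step function on $X\times Y$ is a map $(x,y)\mapsto\phi(g(x),h(y))$ with $g\in\mathrm{Meas}_N(X,\mu)$, $h\in\mathrm{Meas}_N(Y,\nu)$, $\phi\colon N\times N\to k$; $\mathrm{Step}_{k,N}(X,\mu;Y,\nu)$ is the set of these. $N_{S,k}(\alpha,\beta,\epsilon)$ is the least $N\in\mathbb{N}^+$ such that every point of $C^{\alpha\times\beta}_{S,k}$ is within $\mathrm{dist}_\infty$-distance $<\epsilon$ of $M^{\alpha\times\beta}_{S,k}(f)$ for some $f\in\mathrm{Step}_{k,N}(X,\mu;Y,\nu)$; it exists and depends only on $[\alpha],[\beta]$, so one writes $N_{S,k}([\alpha],[\beta],\epsilon)$. *)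

(* Defs.v *)
From HB Require Import structures.
From mathcomp Require Import all_boot all_order all_algebra.
From mathcomp Require Import finmap.
From mathcomp Require Import all_classical all_reals all_analysis.
From mathcomp Require Import monoid.
Unset Printing Implicit Defensive.
Import Order.TTheory GRing.Theory Num.Theory.
Local Open Scope classical_set_scope.
Local Open Scope ring_scope.

Section WeakContainment.
Context (R : realType) (G : groupType).

Definition pt (S : {fset G}) (k : nat) := S -> 'I_k -> 'I_k -> R.

Definition dist_inf (S : {fset G}) (k : nat) (p q : pt S k) : R :=
  \big[Num.max/0]_(g : S) \big[Num.max/0]_(i : 'I_k) \big[Num.max/0]_(j : 'I_k)
     `|p g i j - q g i j|.

Definition is_action (T : Type) (a : G -> T -> T) : Prop :=
  (forall x, a one x = x) /\ (forall g h x, a (mul g h) x = a g (a h x)).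

Definition is_mp_action d (T : measurableType d)
    (mu : {measure set T -> \bar R}) (a : G -> T -> T) : Prop :=
  is_action T a /\
  forall g, measurable_fun setT (a g) /\
            forall A, measurable A -> mu (a g @^-1` A) = mu A.

Definition meas_fin d (T : measurableType d) (k : nat) (f : T -> 'I_k) : Prop :=
  forall i : 'I_k, measurable (f @^-1` [set i]).

Definition Mmat d (T : measurableType d) (mu : {measure set T -> \bar R})
    (a : G -> T -> T) (S : {fset G}) (k : nat) (f : T -> 'I_k) : pt S k :=
  fun g i j => fine (mu ([set x | f x = i] `&` [set x | f (a (val g) x) = j])).

Definition Cset d (T : measurableType d) (mu : {measure set T -> \bar R})
    (a : G -> T -> T) (S : {fset G}) (k : nat) : set (pt S k) :=
  [set p | forall e : R, 0 < e ->
     exists f : T -> 'I_k, meas_fin _ _ k f /\ dist_inf S k p (Mmat _ _ mu a S k f) < e].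

(* [alpha] = (C^alpha_{S,k})_{S,k}, as a point of prod_{S,k} K(I_{S,k}) *)
Definition cls := forall (S : {fset G}) (k : nat), set (pt S k).

Definition clsof d (T : measurableType d) (mu : {measure set T -> \bar R})
    (a : G -> T -> T) : cls := fun S k => Cset _ _ mu a S k.

(* Standard probability spaces are modelled (up to Borel isomorphism) as
   Borel probability measures on the real line.
   [is_rep A P a] : a is a p.m.p. action on the atomless standard
   probability space (R, P) whose weak equivalence class is A. *)
Definition is_rep (A : cls) (P : probability R R) (a : G -> R -> R) : Prop :=
  is_mp_action _ _ P a /\ (forall x : R, P [set x] = 0%E) /\ A = clsof _ _ P a.

Definition Wspace : set cls := [set A | exists P a, is_rep A P a].

Definition prod_act (T U : Type) (a : G -> T -> T) (b : G -> U -> U) :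
    G -> T * U -> T * U :=
  fun g xy => (a g xy.1, b g xy.2).

Definition prodcls (P Q : probability R R) (a b : G -> R -> R) : cls :=
  clsof _ _ (P \x Q)%E (prod_act _ _ a b).

Definition hdist (S : {fset G}) (k : nat) (A B : set (pt S k)) : R :=
  Num.max (sup [set inf [set dist_inf S k p q | q in B] | p in A])
          (sup [set inf [set dist_inf S k p q | p in A] | q in B]).

Definition near_cls (L : seq ({fset G} * nat)) (r : R) (A A' : cls) : Prop :=
  forall (S : {fset G}) (k : nat), (0 < k)%N -> (S, k) \in L ->
    hdist S k (A S k) (A' S k) < r.

Definition closed_WW (C : set (cls * cls)) : Prop :=
  C `<=` Wspace `*` Wspace /\
  forall A B, Wspace A -> Wspace B -> ~ C (A, B) ->
    exists (L : seq ({fset G} * nat)) (r : R), 0 < r /\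
      forall A' B', C (A', B') -> ~ (near_cls L r A A' /\ near_cls L r B B').

(* (1): the map C -> W_Gamma, (a,b) |-> a x b, is continuous.
   a x b := [alpha x beta] for any representatives alpha of a, beta of b. *)
Definition prod_map_continuous (C : set (cls * cls)) : Prop :=
  forall A B, C (A, B) ->
  forall (S : {fset G}) (k : nat), (0 < k)%N ->
  forall e : R, 0 < e ->
  exists (L : seq ({fset G} * nat)) (r : R), 0 < r /\
    forall A' B', C (A', B') -> near_cls L r A A' -> near_cls L r B B' ->
    forall (P Q P' Q' : probability R R) (a b a' b' : G -> R -> R),
      is_rep A P a -> is_rep B Q b -> is_rep A' P' a' -> is_rep B' Q' b' ->
      hdist S k (prodcls P Q a b S k) (prodcls P' Q' a' b' S k) < e.

Definition step_fun (k N : nat) (h : R * R -> 'I_k) : Prop :=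
  exists (g1 g2 : R -> 'I_N) (phi : 'I_N -> 'I_N -> 'I_k),
    meas_fin _ _ N g1 /\ meas_fin _ _ N g2 /\ h = (fun xy => phi (g1 xy.1) (g2 xy.2)).

Definition step_approx (P Q : probability R R) (a b : G -> R -> R)
    (S : {fset G}) (k : nat) (e : R) (N : nat) : Prop :=
  forall p, Cset _ _ (P \x Q)%E (prod_act _ _ a b) S k p ->
    exists h : R * R -> 'I_k, step_fun k N h /\
      dist_inf S k p (Mmat _ _ (P \x Q)%E (prod_act _ _ a b) S k h) < e.

(* N_{S,k}(alpha,beta,e) <= N, N_{S,k} being the least N in N^+ with
   step_approx *)
Definition Nsk_le (P Q : probability R R) (a b : G -> R -> R)
    (S : {fset G}) (k : nat) (e : R) (N : nat) : Prop :=
  exists N', [/\ (0 < N')%N, (N' <= N)%N & step_approx P Q a b S k e N'].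

Definition uniform_step_bound (C : set (cls * cls)) : Prop :=
  forall (S : {fset G}) (k : nat), (0 < k)%N ->
  forall e : R, 0 < e ->
  exists N : nat, (0 < N)%N /\
    forall A B, C (A, B) ->
    forall (P Q : probability R R) (a b : G -> R -> R),
      is_rep A P a -> is_rep B Q b -> Nsk_le P Q a b S k e N.

End WeakContainment.

(* Main.v *)
(* Let the step functions with N parts on each side be the maps phi(g(x), h(y)).
   The matrix of such a map is a fixed polynomial in the matrices of g and h, so
   weakly close pairs of actions have close sets of N-step matrices. A uniform N
   in (2) therefore makes the product continuous. Conversely, N_{S,k} is finite
   at every single pair, by density of step functions in the product space, and
   if the product is continuous then the N of one pair works for all nearby pairs;
   compactness of the space of classes turns this into a uniform bound.

   Compactness is proved along an ultrafilter U. For every action of a sequence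
   pick finitely many functions whose matrices form a net of C_{S,k}, of a size
   that depends only on S, k and the mesh. The itineraries of a point under all
   these functions and all group elements form a point of a shift space
   (labels x Gamma) -> bool; the limit along U of the laws of the itineraries is a
   shift-invariant measure whose C_{S,k} is the limit of the given ones. The
   limit measure is realized as the law of random digits under Lebesgue measure,
   so that no extension theorem is needed, and the shift space is embedded in the
   line by a ternary Cantor code. *)
Require Import Defs.
From HB Require Import structures.
From mathcomp Require Import all_boot all_order all_algebra.
From mathcomp Require Import finmap.
From mathcomp Require Import all_classical all_reals all_analysis.
From mathcomp Require Import measurable_realfun monoid.
From mathcomp Require Import lra ring.
Import Order.TTheory GRing.Theory Num.Theory.
Import numFieldNormedType.Exports.
Local Open Scope classical_set_scope.
Local Open Scope ring_scope.
Set Implicit Arguments.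
Unset Strict Implicit.

(** * The sup metric and the Hausdorff distance *)

Section SupMetric.
Variables (R : realType) (G : groupType) (S : {fset G}) (k : nat).
Implicit Types (p q : pt R G S k) (A B : set (pt R G S k)) (e : R).
Local Notation dist := (dist_inf R G S k).
Local Notation hd := (hdist R G S k).

Lemma dist_le p q e : 0 <= e ->
  (forall g i j, `|p g i j - q g i j| <= e) -> dist p q <= e.
Proof.
move=> e0 h; rewrite /dist_inf.
by do 3!(apply: bigmax_le => // ? _); apply: h.
Qed.

Lemma entry_le_dist p q g i j : `|p g i j - q g i j| <= dist p q.
Proof.
rewrite /dist_inf; apply: le_trans (le_bigmax _ _ g).
by apply: le_trans (le_bigmax _ _ i); apply: (le_bigmax _ (fun j => `|p g i j - q g i j|) j).
Qed.

Lemma dist_ge0 p q : 0 <= dist p q.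
Proof. exact: bigmax_ge_id. Qed.

Lemma distxx p : dist p p = 0.
Proof.
apply/eqP; rewrite eq_le dist_ge0 andbT.
by apply: dist_le => // g i j; rewrite subrr normr0.
Qed.

Lemma distC p q : dist p q = dist q p.
Proof.
rewrite /dist_inf; do 3!(apply: eq_bigr => ? _).
exact: distrC.
Qed.

Lemma dist_triangle q p s : dist p s <= dist p q + dist q s.
Proof.
apply: dist_le => [|g i j]; first by rewrite addr_ge0 ?dist_ge0.
apply: le_trans (ler_distD (q g i j) _ _) _.
by rewrite lerD ?entry_le_dist.
Qed.

Lemma hdistC A B : hd A B = hd B A.
Proof.
rewrite /hdist maxC; congr Num.max; congr (sup _);
  by apply: eq_imagel => p _; congr inf; apply: eq_imagel => q _; rewrite distC.
Qed.

Lemma hdist_le A B e : A !=set0 -> B !=set0 ->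
  (forall p, A p -> exists2 q, B q & dist p q <= e) ->
  (forall q, B q -> exists2 p, A p & dist p q <= e) -> hd A B <= e.
Proof.
move=> [p0 Ap0] [q0 Bq0] hA hB; rewrite /hdist ge_max; apply/andP; split.
  apply: ge_sup; first by exists (inf [set dist p0 q | q in B]), p0.
  move=> _ [p Ap <-]; have [q Bq] := hA p Ap; apply: le_trans.
  apply: ge_inf; last by exists q.
  by exists 0 => _ [? _ <-]; apply: dist_ge0.
apply: ge_sup; first by exists (inf [set dist p q0 | p in A]), q0.
move=> _ [q Bq <-]; have [p Ap] := hB q Bq; apply: le_trans.
apply: ge_inf; last by exists p.
by exists 0 => _ [? _ <-]; apply: dist_ge0.
Qed.

Definition unit_cube : set (pt R G S k) :=
  [set p | forall g i j, 0 <= p g i j <= 1].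

Lemma unit_cube_dist p q : unit_cube p -> unit_cube q -> dist p q <= 1.
Proof.
move=> hp hq; apply: dist_le => // g i j.
have /andP[a b] := hp g i j; have /andP[c d] := hq g i j.
by rewrite ler_norml; lra.
Qed.

(** Distances inside the unit cube are bounded, so the supremum in [hdist] really bounds each inner
    infimum; as the inequality is strict, some point of [B] witnesses it. *)
Lemma hdist_lt_exists A B e p : A `<=` unit_cube -> B `<=` unit_cube ->
  B !=set0 -> hd A B < e -> A p -> exists2 q, B q & dist p q < e.
Proof.
move=> hA hB [q0 Bq0]; rewrite /hdist gt_max => /andP[h _] Ap.
have : inf [set dist p q | q in B] < e.
  apply: le_lt_trans h; apply: ub_le_sup; last by exists p.
  exists 1 => _ [p' Ap' <-]; apply: le_trans (unit_cube_dist (hA _ Ap') (hB _ Bq0)).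
  apply: ge_inf; last by exists q0.
  by exists 0 => _ [? _ <-]; apply: dist_ge0.
move=> /inf_lt [|_ [q Bq <-] hx]; first by exists (dist p q0), q0.
by exists q.
Qed.

(** The cube is cut into cells of diameter at most [e], and one point of [A] is kept from each cell
    that meets [A]. The number [m] of cells is the same for all [A]; this lets one finite set of
    labels serve all actions. *)
Lemma unit_cube_net e : 0 < e -> exists m, forall A, A `<=` unit_cube ->
  A !=set0 -> exists2 x : nat -> pt R G S k, (forall r, A (x r)) &
    forall p, A p -> exists2 r, (r < m)%N & dist p (x r) <= e.
Proof.
move=> e0; pose M := Num.bound e^-1.
have eM : e^-1 < M%:R by rewrite archi_boundP // invr_ge0 ltW.
have M0 : 0 < M%:R :> R by rewrite (lt_trans _ eM) ?invr_gt0.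
have Me : M%:R^-1 <= e.
  by rewrite -[leRHS]invrK lef_pV2 ?posrE ?invr_gt0 // ltW.
pose F := {ffun S * 'I_k * 'I_k -> 'I_M.+1}.
(* Entries are scaled by [M] and truncated; the entry 1 gets the index [M], hence ['I_M.+1]. *)
pose cell p : F := [ffun t => inord (Num.truncn (p t.1.1 t.1.2 t.2 * M%:R))].
have cellP p q : unit_cube p -> unit_cube q -> cell p = cell q -> dist p q <= e.
  move=> hp hq pq; apply: le_trans Me; apply: dist_le => [|g i j].
    by rewrite invr_ge0 ltW.
  have := congr1 (fun f : F => f (g, i, j) : nat) pq.
  have bnd p' : unit_cube p' ->
    0 <= p' g i j * M%:R /\ (Num.truncn (p' g i j * M%:R) < M.+1)%N.
    move=> hp'; have /andP[a b] := hp' g i j.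
    have ge0 : 0 <= p' g i j * M%:R by rewrite mulr_ge0 // ltW.
    split=> //; rewrite ltnS -(ler_nat R); apply: le_trans (_ : p' g i j * M%:R <= _).
      by rewrite truncn_le.
    by rewrite ler_piMl // ltW.
  have [p0 pM] := bnd p hp; have [q0 qM] := bnd q hq.
  rewrite !ffunE /= !inordK // => E.
  have /andP[a b] := truncn_itv p0; have /andP[c d] := truncn_itv q0.
  rewrite E in a b; rewrite -natr1 in b d.
  rewrite -(ler_pM2r M0) mulVf ?gt_eqF // -[X in _ * X]gtr0_norm //.
  by rewrite -normrM mulrBl ler_norml; lra.
exists #|F| => A hA [p0 Ap0].
pose good r p := A p /\ exists2 h : (r < #|F|)%N, True & cell p = enum_val (Ordinal h).
(* A cell that misses [A] gets the default [p0], so every [x r] lies in [A]. *)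
pose x r := if pselect (exists p, good r p) is left h then projT1 (cid h) else p0.
have xP r p : good r p -> good r (x r).
  rewrite /x; case: pselect => [h _|nh gp]; first by case: cid.
  by case: nh; exists p.
exists x => [r|p Ap].
  by rewrite /x; case: pselect => // h; case: cid => ? [].
pose r := enum_rank (cell p).
have gp : good r p.
  split=> //; exists (ltn_ord r) => //.
  by rewrite (_ : Ordinal _ = r) ?enum_rankK //; apply: val_inj.
exists r => //; have [Ax [h _ hx]] := xP _ _ gp; have [_ [h' _ hp]] := gp.
apply: cellP; [exact: hA|exact: hA|].
by rewrite hx hp; congr enum_val; apply: val_inj.
Qed.

End SupMetric.

(** * Approximation of measurable functions by coordinates *)

Definition fine_measure d (T : measurableType d) (R : realType)
  (mu : {measure set T -> \bar R}) (A : set T) : R := fine (mu A).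

(** Measurability for maps into discrete ranges that carry no sigma-algebra; for [V = 'I_k] it is
    convertible with [meas_fin]. *)
Definition fibre_measurable d (T : measurableType d) (V : Type) (W : T -> V) :=
  forall v, measurable (W @^-1` [set v]).

Lemma fibre_measurable_preimage d (T : measurableType d) (V : finType)
    (W : T -> V) (A : set V) : fibre_measurable W -> measurable (W @^-1` A).
Proof.
move=> mW; rewrite (_ : W @^-1` A = \bigcup_(v in A) (W @^-1` [set v])).
  by apply: fin_bigcup_measurable => // v _; apply: mW.
by apply/seteqP; split=> [s As|s [v Av /= ->]] //; exists (W s).
Qed.

Lemma fibre_measurable_comp d (T : measurableType d) (V : finType) (V' : Type)
    (W : T -> V) (f : V -> V') : fibre_measurable W -> fibre_measurable (f \o W).
Proof. by move=> mW v; apply: (fibre_measurable_preimage (f @^-1` [set v])). Qed.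

Lemma fibre_measurable_comp_fun d d' (T : measurableType d)
    (T' : measurableType d') (V : Type) (W : T -> V) (f : T' -> T) :
  measurable_fun setT f -> fibre_measurable W -> fibre_measurable (W \o f).
Proof. by move=> mf mW v; rewrite -[X in measurable X]setTI; exact: (mf measurableT _ (mW v)). Qed.

Lemma fibre_measurable_bool d (T : measurableType d) (c : T -> bool) :
  measurable [set s | c s] -> fibre_measurable c.
Proof.
move=> mc [].
  by rewrite (_ : _ @^-1` _ = [set s | c s]) //; apply/seteqP; split.
rewrite (_ : _ @^-1` _ = ~` [set s | c s]); first exact: measurableC.
by apply/seteqP; split=> s /= => [->|/negP/negbTE].
Qed.

Lemma fibre_measurable_pair d (T : measurableType d) (V V' : eqType)
    (W : T -> V) (W' : T -> V') : fibre_measurable W -> fibre_measurable W' ->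
  fibre_measurable (fun s => (W s, W' s)).
Proof.
move=> mW mW' [v v'].
rewrite (_ : _ @^-1` _ = W @^-1` [set v] `&` W' @^-1` [set v']).
  exact: measurableI.
by apply/seteqP; split=> s /= => [[-> ->]|[-> ->]].
Qed.

Lemma fibre_measurable_map d (T : measurableType d) (X : Type)
    (ev : X -> T -> bool) (J : seq X) :
  (forall i, measurable [set s | ev i s]) ->
  fibre_measurable (fun s => [seq ev i s | i <- J]).
Proof.
move=> mev; elim: J => [|i J IH] w.
  have [->|nw] := eqVneq w [::].
    by rewrite (_ : _ @^-1` _ = setT) //; apply/seteqP; split.
  rewrite (_ : _ @^-1` _ = set0) //; apply/seteqP; split=> s //= h.
  by rewrite -h eqxx in nw.
case: w => [|b w].
  by rewrite (_ : _ @^-1` _ = set0) //; apply/seteqP; split.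
rewrite (_ : _ @^-1` _ = ev i @^-1` [set b] `&`
   (fun s => [seq ev i s | i <- J]) @^-1` [set w]).
  by apply: measurableI; [exact: fibre_measurable_bool|exact: IH].
by apply/seteqP; split=> s /= => [[-> ->]|[-> ->]].
Qed.

(** The bits read along [J] form a tuple, an element of a finite type, and any function of it keeps
    measurable fibres. *)
Lemma fibre_measurable_sees d (T : measurableType d) (X : Type) (V : Type)
    (ev : X -> T -> bool) (J : seq X) (psi : seq bool -> V) :
  (forall i, measurable [set s | ev i s]) ->
  fibre_measurable (fun s => psi [seq ev i s | i <- J]).
Proof.
move=> mev; pose W s := [tuple of [seq ev i s | i <- in_tuple J]].
have mW : fibre_measurable W.
  move=> v; have := fibre_measurable_map J mev v; congr (measurable _).
  by apply/seteqP; split=> s /= => [h|<- //]; apply: val_inj.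
exact: (fibre_measurable_comp (fun w : (size J).-tuple bool => psi w) mW).
Qed.

Section ProbabilityMeasure.
Context d (T : measurableType d) (R : realType) (mu : {measure set T -> \bar R}).
Hypothesis mu1 : mu setT = 1%E.
Local Notation pr := (fine_measure mu).
Implicit Types A B D : set T.

Lemma fine_measureK A : measurable A -> (pr A)%:E = mu A.
Proof.
move=> mA; rewrite fineK // ge0_fin_numE ?measure_ge0 //.
by apply: le_lt_trans (ltry 1); rewrite -mu1 le_measure ?inE.
Qed.

Lemma fine_measure_ge0 A : 0 <= pr A.
Proof. by rewrite fine_ge0. Qed.

Lemma fine_measure_le A B : measurable A -> measurable B -> A `<=` B ->
  pr A <= pr B.
Proof.
by move=> mA mB AB; rewrite -lee_fin !fine_measureK // le_measure ?inE.
Qed.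

Lemma fine_measureT : pr setT = 1.
Proof. by rewrite /fine_measure mu1. Qed.

Lemma fine_measure0 : pr set0 = 0.
Proof. by rewrite /fine_measure measure0. Qed.

Lemma fine_measure_le1 A : measurable A -> pr A <= 1.
Proof. by move=> mA; rewrite -fine_measureT fine_measure_le. Qed.

Lemma fine_measureU A B : measurable A -> measurable B -> A `&` B = set0 ->
  pr (A `|` B) = pr A + pr B.
Proof.
move=> mA mB AB; apply: EFin_inj.
by rewrite EFinD !fine_measureK ?measureU //; apply: measurableU.
Qed.

Lemma fine_measureU_le A B : measurable A -> measurable B ->
  pr (A `|` B) <= pr A + pr B.
Proof.
move=> mA mB.
rewrite -lee_fin EFinD !fine_measureK //; last exact: measurableU.
exact: measureU2.
Qed.

Lemma fine_measure_near A B D : measurable A -> measurable B -> measurable D ->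
  A `<=` B `|` D -> pr A <= pr B + pr D.
Proof.
move=> mA mB mD sub; apply: le_trans (fine_measureU_le mB mD).
by apply: fine_measure_le => //; apply: measurableU.
Qed.

Lemma fine_measure_sum (V : finType) (W : T -> V) (P : pred V) :
  fibre_measurable W ->
  pr [set s | P (W s)] = \sum_(v | P v) pr (W @^-1` [set v]).
Proof.
move=> mW; rewrite -big_enum /=.
have -> : [set s | P (W s)] = [set s | W s \in enum P].
  by apply/seteqP; split=> s /=; rewrite mem_enum.
elim: (enum P) (enum_uniq P) => [_|v r IH /= /andP[vr ur]].
  rewrite big_nil (_ : [set _ | _] = set0) ?fine_measure0 //.
  by apply/seteqP; split.
rewrite big_cons -IH // -fine_measureU.
- congr (pr _); apply/seteqP; split=> s /=; rewrite in_cons.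
    by case/orP=> [/eqP|]; [left|right].
  by case=> [->|->]; rewrite ?eqxx ?orbT.
- exact: mW.
- exact: (fibre_measurable_preimage [set v | v \in r]).
- by apply/seteqP; split=> s //= [-> /= vr']; rewrite vr' in vr.
Qed.

Section Approximation.
Context (X : Type) (ev : X -> T -> bool).
Hypothesis mev : forall i, measurable [set s | ev i s].
Hypothesis gen : forall A, measurable A -> <<s [set [set s | ev i s] | i in setT] >> A.
Local Notation sees J s := [seq ev i s | i <- J].
Local Notation simple J phi := [set s | phi (sees J s)].

Let measurable_simple J (phi : seq bool -> bool) : measurable (simple J phi).
Proof. exact: (fibre_measurable_sees J phi mev true). Qed.

Definition symdiff A B := (A `\` B) `|` (B `\` A).

Let measurable_symdiff A B : measurable A -> measurable B -> measurable (symdiff A B).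
Proof. by move=> mA mB; apply: measurableU; apply: measurableD. Qed.

Let approx A := forall e : R, 0 < e ->
  exists J (phi : seq bool -> bool), pr (symdiff A (simple J phi)) <= e.

Let approxC A : approx A -> approx (~` A).
Proof.
move=> hA e /hA[J [phi h]]; exists J, (fun w => ~~ phi w).
rewrite [X in symdiff _ X](_ : _ = ~` simple J phi).
  by rewrite /symdiff !setDE !setCK setUC setIC [X in _ `|` X]setIC.
by apply/seteqP; split=> s /= /negP.
Qed.

Let approx0 : approx set0.
Proof.
move=> e e0; exists [::], xpred0; rewrite (_ : symdiff _ _ = set0).
  by rewrite fine_measure0 ltW.
by apply/seteqP; split=> s //; rewrite /symdiff /= => -[[? ?]|[? ?]].
Qed.

Let approxU A B : measurable A -> measurable B -> approx A -> approx B -> approx (A `|` B).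
Proof.
move=> mA mB hA hB e e0; have e20 : 0 < e / 2 by rewrite divr_gt0.
have [J [phi hJ]] := hA _ e20; have [K [psi hK]] := hB _ e20.
(* The lists are concatenated and each predicate reads its own part of the word. *)
exists (J ++ K), (fun w => phi (take (size J) w) || psi (drop (size J) w)).
set E : set T := [set _ | _].
have ED : E = simple J phi `|` simple K psi.
  apply/seteqP; split=> s; rewrite /E /= map_cat take_size_cat ?size_map //
    drop_size_cat ?size_map //.
    by case/orP; [left|right].
  by case=> ->; rewrite ?orbT.
have mE : measurable E by rewrite ED; apply: measurableU.
have -> : e = e / 2 + e / 2 by lra.
apply: le_trans (lerD hJ hK); apply: fine_measure_near.
- by apply: measurable_symdiff => //; apply: measurableU.
- exact: measurable_symdiff.
- exact: measurable_symdiff.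
- move=> s; rewrite ED /symdiff /=; tauto.
Qed.

(** By continuity from above, the union exceeds some finite union [H n] by mass at most [e / 2];
    finite unions are covered by [approxU]. *)
Let approx_bigcup (F : nat -> set T) : (forall n, measurable (F n)) ->
  (forall n, approx (F n)) -> approx (\bigcup_n F n).
Proof.
move=> mF hF e e0; pose H n := \big[setU/set0]_(i < n) F i.
have mH n : measurable (H n) by apply: bigsetU_measurable.
have hH n : approx (H n).
  elim: n => [|n IH]; first by rewrite /H big_ord0; apply: approx0.
  by rewrite /H big_ord_recr /=; apply: approxU => //; apply: mH.
have mU : measurable (\bigcup_n F n) by apply: bigcup_measurable.
have e20 : 0 < e / 2 by rewrite divr_gt0.
have [n hn] : exists n, pr (\bigcup_n F n `\` H n) <= e / 2.
  have := @nonincreasing_cvg_mu _ _ _ mu (fun n => \bigcup_n F n `\` H n).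
  have capE : \bigcap_n (\bigcup_n F n `\` H n) = set0.
    apply/seteqP; split=> // s hs; have [[n _ Fns] _] := hs 0 I.
    by have [_] := hs n.+1 I; apply; rewrite /H big_ord_recr; right.
  rewrite capE measure0 => cv.
  have {}cv : (mu \o (fun n => \bigcup_n F n `\` H n)) x @[x --> \oo] --> 0%E.
    apply: cv.
    - by rewrite -fine_measureK ?ltry //; apply: measurableD.
    - by move=> i; apply: measurableD.
    - exact: measurable0.
    - move=> i j ij; apply/subsetPset => s /= [Us Hs]; split=> // Hi; apply: Hs.
      move: Hi; rewrite /H -!bigcup_mkord => -[m /= mi Fm]; exists m => //=.
      exact: leq_trans mi ij.
  have /cv [n _ hn] : nbhs (0%E : \bar R) [set x | (x < (e / 2)%:E)%E].
    exact: (@nbhs_open_ereal_lt _ 0 (fun=> e / 2)).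
  exists n; rewrite -lee_fin fine_measureK; last exact: measurableD.
  by apply/ltW/(hn n) => /=.
have [J [phi hJ]] := hH n _ e20; exists J, phi.
have -> : e = e / 2 + e / 2 by lra.
apply: le_trans (lerD hn hJ); apply: fine_measure_near.
- exact: measurable_symdiff.
- exact: measurableD.
- exact: measurable_symdiff.
- move=> s; rewrite /symdiff /=.
  have : H n s -> (\bigcup_n F n) s.
    by rewrite /H -bigcup_mkord => -[i _ Fi]; exists i.
  by have [] := pselect (H n s); tauto.
Qed.

(** The measurable sets that are approximable by events on finitely many coordinates form a
    sigma-algebra containing the generators. *)
Lemma measurable_approx A : measurable A -> forall e : R, 0 < e ->
  exists J (phi : seq bool -> bool), pr (symdiff A (simple J phi)) <= e.
Proof.
move=> /gen sA.
suff : (<<s [set [set s | ev i s] | i in setT] >> `<=` measurable `&` approx).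
  by move=> /(_ A sA)[].
apply: smallest_sub => [|_ [i _ <-]].
  split=> [|B [mB hB]|F hF].
  - by split=> //; apply: approx0.
  - by rewrite setTD; split; [exact: measurableC|exact: approxC].
  - split; first by apply: bigcup_measurable => n _; have [] := hF n.
    by apply: approx_bigcup => n; have [] := hF n.
split=> // e e0; exists [:: i], (head false).
rewrite (_ : symdiff _ _ = set0) ?fine_measure0 ?ltW //.
by apply/seteqP; split=> s; rewrite /symdiff /=; tauto.
Qed.

(** Each of the [k] level sets is approximated within [e / k], and [psi] returns an index whose
    approximating event holds. A point where [psi] and [f] disagree lies in one of the symmetric
    differences. *)
Lemma meas_fin_approx k (f : T -> 'I_k) (e : R) : (0 < k)%N -> meas_fin _ T k f ->
  0 < e -> exists J (psi : seq bool -> 'I_k),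
    fibre_measurable (fun s => psi (sees J s)) /\
    pr [set s | f s != psi (sees J s)] <= e.
Proof.
move=> k0 mf e0; pose e' := e / k%:R.
have e'0 : 0 < e' by rewrite divr_gt0 ?ltr0n.
have [J [Phi HPhi]] : exists J (Phi : 'I_k -> seq bool -> bool),
    forall i, pr (symdiff (f @^-1` [set i]) (simple J (Phi i))) <= e'.
  suff : forall r : seq 'I_k, exists J (Phi : 'I_k -> seq bool -> bool),
      forall i, i \in r -> pr (symdiff (f @^-1` [set i]) (simple J (Phi i))) <= e'.
    move=> /(_ (enum 'I_k))[J [Phi h]]; exists J, Phi => i.
    by apply: h; rewrite mem_enum.
  elim=> [|i r [J [Phi IH]]]; first by exists [::], (fun _ _ => true).
  have [K [phi hK]] := measurable_approx (mf i) e'0.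
  exists (K ++ J), (fun j w => if j == i then phi (take (size K) w)
                              else Phi j (drop (size K) w)) => j.
  have [-> _|ji] := eqVneq j i.
    rewrite [X in symdiff _ X](_ : _ = simple K phi) //.
    by apply/seteqP; split=> s /=; rewrite map_cat take_size_cat ?size_map.
  rewrite in_cons (negbTE ji) /= => /IH.
  rewrite [X in _ -> pr (symdiff _ X) <= _](_ : _ = simple J (Phi j)) //.
  by apply/seteqP; split=> s /=; rewrite map_cat drop_size_cat ?size_map.
pose i0 := Ordinal k0.
(* The default [i0] is taken only when no event holds; such a point lies in the symmetric difference
   of its own level set. *)
pose psi w := odflt i0 [pick i | Phi i w]; exists J, psi.
have mpsi := fibre_measurable_sees J psi mev.
split=> //.
pose E i := symdiff (f @^-1` [set i]) (simple J (Phi i)).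
have mE i : measurable (E i) by apply: measurable_symdiff => //; apply: mf.
have sub : [set s | f s != psi (sees J s)] `<=` \big[setU/set0]_(i < k) E i.
  move=> s /= ne; apply: contrapT => nE.
  have {}nE i : ~ E i s.
    by move=> Ei; apply: nE; rewrite (bigD1 i) //; left.
  case/eqP: ne; rewrite /psi; case: pickP => [i /= hi|/(_ (f s)) /= h].
    by apply: contrapT => fi; apply: (nE i); right.
  by case: (nE (f s)); left; split => //=; rewrite h.
have mU n (h : (n <= k)%N) : measurable (\big[setU/set0]_(i < n) E (widen_ord h i)).
  exact: bigsetU_measurable.
have bnd n (h : (n <= k)%N) : pr (\big[setU/set0]_(i < n) E (widen_ord h i)) <= n%:R * e'.
  elim: n h => [|n IH] h; first by rewrite big_ord0 fine_measure0 mul0r.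
  rewrite big_ord_recr /= -natr1 mulrDl mul1r.
  have hn := ltnW h.
  rewrite (eq_bigr (fun i => E (widen_ord hn i))); last first.
    by move=> i _; congr E; apply: val_inj.
  apply: le_trans (fine_measureU_le (mU n hn) (mE _)) _.
  by apply: lerD; [exact: IH|exact: HPhi].
have := bnd k (leqnn k); rewrite (eq_bigr E); last first.
  by move=> i _; congr E; apply: val_inj.
rewrite /e' mulrC divfK ?pnatr_eq0 -?lt0n // => le_e; apply: le_trans le_e.
apply: fine_measure_le => //; last exact: bigsetU_measurable.
have mp := fibre_measurable_pair mf mpsi.
exact: (fibre_measurable_preimage [set v : 'I_k * 'I_k | v.1 != v.2] mp).
Qed.

End Approximation.
End ProbabilityMeasure.

(** * Statistics matrices *)

Section StatisticsMatrix.
Context (R : realType) (G : groupType) d (T : measurableType d).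
Variables (mu : {measure set T -> \bar R}) (a : G -> T -> T).
Hypothesis mu1 : mu setT = 1%E.
Hypothesis mp : is_mp_action R G d T mu a.
Variables (S : {fset G}) (k : nat).
Local Notation pr := (fine_measure mu).
Local Notation M := (Mmat R G d T mu a S k).
Local Notation C := (Cset R G d T mu a S k).

Let ma g : measurable_fun setT (a g).
Proof. by case: (mp.2 g). Qed.

Lemma measurable_joint (f : T -> 'I_k) g i j : meas_fin d T k f ->
  measurable ([set x | f x = i] `&` [set x | f (a g x) = j]).
Proof.
move=> mf; apply: measurableI; first exact: mf.
exact: (fibre_measurable_comp_fun (ma g) mf).
Qed.

Lemma Mmat_unit_cube f : meas_fin d T k f -> unit_cube (M f).
Proof.
move=> mf g i j; rewrite fine_measure_ge0 (fine_measure_le1 mu1) //.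
exact: measurable_joint.
Qed.

Lemma Mmat_Cset f : meas_fin d T k f -> C (M f).
Proof. by move=> mf e e0; exists f; rewrite distxx. Qed.

Lemma Cset_unit_cube : C `<=` @unit_cube R G S k.
Proof.
move=> p Cp g i j.
have h (e : R) : 0 < e -> 0 - e <= p g i j <= 1 + e.
  move=> /Cp[f [mf hf]].
  have := le_lt_trans (entry_le_dist p (M f) g i j) hf.
  have /andP[] := Mmat_unit_cube mf g i j.
  by rewrite ltr_norml => ? ? /andP[? ?]; apply/andP; split; lra.
apply/andP; split; apply/ler_addgt0Pr => e /h /andP[? ?]; lra.
Qed.

Lemma Cset_nonempty : (0 < k)%N -> C !=set0.
Proof.
move=> k0; exists (M (fun=> Ordinal k0)); apply: Mmat_Cset => i.
have [->|ni] := eqVneq i (Ordinal k0).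
  by rewrite (_ : _ @^-1` _ = setT) //; apply/seteqP; split.
rewrite (_ : _ @^-1` _ = set0) //; apply/seteqP; split=> // x /= h.
by rewrite -h eqxx in ni.
Qed.

(** The joint events of [f] and [f'] differ only where the functions disagree at [x] or at its
    translate. By invariance both sets have mass at most [e], hence the factor 2. *)
Lemma Mmat_close (f f' : T -> 'I_k) (e : R) : meas_fin d T k f ->
  meas_fin d T k f' -> pr [set x | f x != f' x] <= e ->
  dist_inf R G S k (M f) (M f') <= 2 * e.
Proof.
move=> mf mf' he; set D := [set x | _] in he.
have mD : measurable D.
  exact: (fibre_measurable_preimage [set v : 'I_k * 'I_k | v.1 != v.2]
    (fibre_measurable_pair mf mf')).
have e0 : 0 <= e by apply: le_trans he; apply: fine_measure_ge0.
apply: dist_le => [|g i j]; first by rewrite mulr_ge0.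
have maD : measurable (a (val g) @^-1` D).
  by rewrite -[X in measurable X]setTI; apply: ma.
have bound (f1 f2 : T -> 'I_k) : meas_fin d T k f1 -> meas_fin d T k f2 ->
    (forall x, ~ D x -> f1 x = f2 x) -> M f1 g i j <= M f2 g i j + 2 * e.
  move=> m1 m2 D12.
  apply: le_trans (fine_measure_near mu1 _ (measurable_joint (val g) i j m2)
    (measurableU _ _ mD maD) _) _.
  - exact: measurable_joint.
  - move=> x [/= h1 h2]; have [Dx|nDx] := pselect (D x); first by right; left.
    have [Dgx|nDgx] := pselect (D (a (val g) x)); first by right; right.
    by left; rewrite /= -!D12.
  - rewrite lerD2l; apply: le_trans (fine_measureU_le mu1 mD maD) _.
    rewrite [fine_measure _ (_ @^-1` _)]/fine_measure (mp.2 _).2 //.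
    by rewrite mulr2n mulrDl !mul1r lerD.
have Deq x : ~ D x -> f x = f' x by move=> /negP; rewrite negbK => /eqP.
rewrite ler_distl; apply/andP; split; last exact: bound.
by rewrite lerBlDr; apply: bound => // x /Deq.
Qed.

End StatisticsMatrix.

(** Pulling back along [f] preserves matrices, and every [u] on [T] is the pullback of [u \o g].
    Surjectivity of [f] is not assumed, so an embedding suffices. *)
Lemma Cset_isomorphic (R : realType) (G : groupType) d d' (T : measurableType d)
    (T' : measurableType d') (mu : {measure set T -> \bar R})
    (mu' : {measure set T' -> \bar R}) (a : G -> T -> T) (a' : G -> T' -> T')
    (f : T -> T') (g : T' -> T) (S : {fset G}) (k : nat) :
  is_mp_action R G d' T' mu' a' ->
  measurable_fun setT f -> measurable_fun setT g -> cancel f g ->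
  (forall x h, f (a h x) = a' h (f x)) ->
  (forall A, measurable A -> mu' A = mu (f @^-1` A)) ->
  Cset R G d' T' mu' a' S k = Cset R G d T mu a S k.
Proof.
move=> mp mf mg fK fa muE.
have M_f (u : T' -> 'I_k) : meas_fin d' T' k u ->
    Mmat R G d T mu a S k (u \o f) = Mmat R G d' T' mu' a' S k u.
  move=> mu_; apply/funext => h; apply/funext => i; apply/funext => j.
  rewrite /Mmat muE; last exact: (measurable_joint mp).
  by congr (fine (mu _)); apply/seteqP; split=> x; rewrite /= fa.
apply/seteqP; split=> p Cp e /Cp[u [mu_ hu]].
  exists (u \o f); rewrite M_f //; split=> //.
  exact: (fibre_measurable_comp_fun mf mu_).
have mug : meas_fin d' T' k (u \o g) := fibre_measurable_comp_fun mg mu_.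
exists (u \o g); split=> //; rewrite -M_f //.
by rewrite (_ : _ \o _ = u) //; apply/funext => x /=; rewrite fK.
Qed.

(** * Product actions and step functions *)

Section ProductAction.
Context (R : realType) (G : groupType).
Variables (P Q : probability R R) (a b : G -> R -> R).
Hypothesis mpa : is_mp_action R G _ R P a.
Hypothesis mpb : is_mp_action R G _ R Q b.
Local Notation PQ := (P \x Q)%E.
Local Notation ab := (prod_act G R R a b).
Local Notation pr := (fine_measure PQ).

Lemma product_probability_setT : PQ setT = 1%E.
Proof.
rewrite -setXTT product_measure1E // -[RHS]mule1.
by congr (_ * _)%E; apply: probability_setT.
Qed.

(** The image of the product measure under the diagonal map agrees with it on rectangles, which
    determine the product measure. *)
Lemma prod_act_mp : is_mp_action R G _ (R * R)%type PQ ab.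
Proof.
split; first split.
- by move=> [x y]; rewrite /prod_act /= mpa.1.1 mpb.1.1.
- by move=> g h [x y]; rewrite /prod_act /= mpa.1.2 mpb.1.2.
move=> g; have [ma Pa] := mpa.2 g; have [mb Qb] := mpb.2 g.
have mab : measurable_fun setT (ab g).
  by apply: measurable_fun_pair; apply: measurableT_comp.
split=> // A mA.
pose f : {mfun _ >-> _} := HB.pack (ab g) (isMeasurableFun.Build _ _ _ _ _ mab).
apply/esym/(product_measure_unique (m' := pushforward PQ f)) => //.
move=> B D mB mD; rewrite -Pa // -Qb //.
apply: (@product_measure1E _ _ _ _ _ P Q (a g @^-1` B) (b g @^-1` D)).
  by rewrite -[X in measurable X]setTI; apply: ma.
by rewrite -[X in measurable X]setTI; apply: mb.
Qed.

(* Coordinates [(true, A)] and [(false, A)] test membership in [A] of the first,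
   respectively the second, component. *)
Definition side_set := (bool * {A : set R | measurable A})%type.

Definition side_mem (c : side_set) (xy : R * R) : bool :=
  `[< sval c.2 (if c.1 then xy.1 else xy.2) >].

Lemma measurable_side_mem c : measurable [set xy | side_mem c xy].
Proof.
case: c => -[] [A mA].
  rewrite (_ : [set _ | _] = A `*` setT); first exact: measurableX.
  by apply/seteqP; split=> x /=; [move=> /asboolP|case=> ? _; apply/asboolP].
rewrite (_ : [set _ | _] = setT `*` A); first exact: measurableX.
by apply/seteqP; split=> x /=; [move=> /asboolP|case=> _ ?; apply/asboolP].
Qed.

Lemma side_mem_generate (A : set (R * R)) : measurable A ->
  <<s [set [set xy | side_mem c xy] | c in setT] >> A.
Proof.
move=> mA; move: (mA : (<<s preimage_set_system setT fst measurable `|`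
  preimage_set_system setT snd measurable >> A)); apply: smallest_sub.
  exact: smallest_sigma_algebra.
move=> _ [] [B mB <-]; apply: sub_sigma_algebra.
  exists (true, exist _ B mB) => //.
  by apply/seteqP; split=> x /=; [move=> /asboolP|case=> _ ?; apply/asboolP].
exists (false, exist _ B mB) => //.
by apply/seteqP; split=> x /=; [move=> /asboolP|case=> _ ?; apply/asboolP].
Qed.

(** Each side records its memberships in all the sets of [J], which gives 2^|J| parts; [phi] then
    takes every bit from the side named by its label. *)
Lemma step_fun_side_mem k (J : seq side_set) (psi : seq bool -> 'I_k) :
  exists2 N, (0 < N)%N & step_fun R k N (fun xy => psi [seq side_mem c xy | c <- J]).
Proof.
pose mem (x : R) : (size J).-tuple bool :=
  [tuple of [seq `[< sval c.2 x >] | c : side_set <- in_tuple J]].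
have mmem : fibre_measurable mem.
  move=> v; have mev (c : side_set) : measurable [set x | `[< sval c.2 x >]].
    case: c => c1 [A mA] /=; rewrite (_ : [set _ | _] = A) //.
    by apply/seteqP; split=> x /asboolP.
  have := fibre_measurable_map J mev v; congr (measurable _).
  by apply/seteqP; split=> s /= => [h|<- //]; apply: val_inj.
pose g x := enum_rank (mem x).
have mg : meas_fin _ R #|{: (size J).-tuple bool}| g.
  exact: (fibre_measurable_comp enum_rank mmem).
exists #|{: (size J).-tuple bool}|.
  by apply/card_gt0P; exists [tuple of nseq _ true].
exists g, g, (fun u v => psi [seq if p.1.1 then p.2.1 else p.2.2 |
  p <- zip J (zip (tval (enum_val u)) (tval (enum_val v)))]).
split=> //; split=> //; apply/funext => -[x y] /=.
rewrite !enum_rankK /=; congr psi.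
elim: (J) => //= c J' ->; congr cons.
by rewrite /side_mem; case: c.1.
Qed.

Lemma step_fun_widen k N N' (h : R * R -> 'I_k) : (0 < N)%N -> (N <= N')%N ->
  step_fun R k N h -> step_fun R k N' h.
Proof.
move=> N0 NN' [g1 [g2 [phi [m1 [m2 ->]]]]].
(* The added parts are empty; [back] sends their indices to 0. *)
pose back (u : 'I_N') := insubd (Ordinal N0) (val u).
have backK u : back (widen_ord NN' u) = u.
  by apply: val_inj; rewrite /back val_insubd /= ltn_ord.
exists (widen_ord NN' \o g1), (widen_ord NN' \o g2),
  (fun u v => phi (back u) (back v)); split.
  exact: (fibre_measurable_comp (widen_ord NN') m1).
split; first exact: (fibre_measurable_comp (widen_ord NN') m2).
by apply/funext => -[x y] /=; rewrite !backK.
Qed.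

Lemma step_fun_meas_fin k N (h : R * R -> 'I_k) : step_fun R k N h ->
  meas_fin _ (R * R)%type k h.
Proof.
move=> [g1 [g2 [phi [m1 [m2 ->]]]]].
have := fibre_measurable_pair (fibre_measurable_comp_fun measurable_fst m1)
  (fibre_measurable_comp_fun measurable_snd m2).
exact: (fibre_measurable_comp (fun p => phi p.1 p.2)).
Qed.

(** Finiteness of N_{S,k} at a single pair: step functions approximate each point of a finite net of
    the class, and the largest of the finitely many part numbers serves all of them. *)
Lemma exists_step_approx (S : {fset G}) k (e : R) : (0 < k)%N -> 0 < e ->
  exists2 N, (0 < N)%N & step_approx R G P Q a b S k e N.
Proof.
move=> k0 e0; pose C := Cset R G _ _ PQ ab S k.
pose M := Mmat R G _ _ PQ ab S k.
have PQ1 := product_probability_setT; have mp := prod_act_mp.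
have e20 : 0 < e / 2 by rewrite divr_gt0.
(* Realizing a point by a function costs [e / 4], and passing to a step function costs twice
   [e / 8]; the sum [e / 2] is added to the mesh of the net. *)
have e40 : 0 < e / 4 by rewrite divr_gt0.
have e80 : 0 < e / 8 by rewrite divr_gt0.
have [m net] := @unit_cube_net R G S k _ e20.
have [x Cx hx] := net C (Cset_unit_cube PQ1 mp (k := k)) (Cset_nonempty _ _ S k0).
have one p : C p -> exists2 N, (0 < N)%N &
    exists2 h, step_fun R k N h & dist_inf R G S k p (M h) < e / 2.
  move=> /(_ _ e40)[f [mf hf]].
  have [J [psi [mpsi hpsi]]] :=
    meas_fin_approx PQ1 measurable_side_mem side_mem_generate k0 mf e80.
  have [N N0 hN] := step_fun_side_mem J psi.
  exists N => //; eexists; first exact: hN.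
  have close := Mmat_close PQ1 mp S mf mpsi hpsi.
  apply: le_lt_trans (dist_triangle _ _ _) _; apply: lt_le_trans (ltr_leD hf close) _.
  lra.
have [N N0 hN] : exists2 N, (0 < N)%N & forall r, (r < m)%N ->
    exists2 h, step_fun R k N h & dist_inf R G S k (x r) (M h) < e / 2.
  elim: (m) => [|n [N N0 IH]]; first by exists 1%N.
  have [N' N'0 [h hh hd]] := one _ (Cx n).
  exists (maxn N N') => [|r]; first by rewrite leq_max N0.
  rewrite ltnS leq_eqVlt => /orP[/eqP ->|/IH[h' sh' hh']].
    by exists h => //; apply: step_fun_widen hh; rewrite ?leq_maxr.
  by exists h' => //; apply: step_fun_widen sh'; rewrite ?leq_maxl.
exists N => // p /hx[r /hN[h sh hh] hr]; exists h; split=> //.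
apply: le_lt_trans (dist_triangle _ _ _) _.
by apply: lt_le_trans (ler_ltD hr hh) _; lra.
Qed.

(** The event is split by the values of [g1] and [g2] at the point and at its translate. Each piece
    is a rectangle, so its mass is a product of one entry from each factor. *)
Lemma Mmat_step (S : {fset G}) k N (g1 g2 : R -> 'I_N) (phi : 'I_N -> 'I_N -> 'I_k) g i j :
  meas_fin _ R N g1 -> meas_fin _ R N g2 ->
  Mmat R G _ _ PQ ab S k (fun xy => phi (g1 xy.1) (g2 xy.2)) g i j =
  \sum_(t : ('I_N * 'I_N) * ('I_N * 'I_N) |
      (phi t.1.1 t.2.1 == i) && (phi t.1.2 t.2.2 == j))
    Mmat R G _ _ P a S N g1 g t.1.1 t.1.2 * Mmat R G _ _ Q b S N g2 g t.2.1 t.2.2.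
Proof.
move=> m1 m2.
have [ma _] := mpa.2 (val g); have [mb _] := mpb.2 (val g).
pose W xy := ((g1 xy.1, g1 (a (val g) xy.1)), (g2 xy.2, g2 (b (val g) xy.2))).
have mW : fibre_measurable W.
  apply: fibre_measurable_pair; apply: fibre_measurable_pair.
  - exact: (fibre_measurable_comp_fun measurable_fst m1).
  - apply: (fibre_measurable_comp_fun _ m1).
    exact: (measurableT_comp ma measurable_fst).
  - exact: (fibre_measurable_comp_fun measurable_snd m2).
  - apply: (fibre_measurable_comp_fun _ m2).
    exact: (measurableT_comp mb measurable_snd).
rewrite /Mmat -/(fine_measure _ _).
rewrite (_ : _ `&` _ = [set xy | (phi (W xy).1.1 (W xy).2.1 == i) &&
    (phi (W xy).1.2 (W xy).2.2 == j)]); last first.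
  by apply/seteqP; split=> xy /=; [case=> -> ->; rewrite !eqxx|
    case/andP=> /eqP ? /eqP ?].
rewrite (fine_measure_sum product_probability_setT (fun t => (phi t.1.1 t.2.1 == i) &&
  (phi t.1.2 t.2.2 == j)) mW); apply: eq_bigr => -[[u u'] [v v']] _ /=.
have mA := measurable_joint mpa (val g) u u' m1.
have mB := measurable_joint mpb (val g) v v' m2.
rewrite -fineM -?product_measure1E //; last 2 first.
- by rewrite -(fine_measureK (probability_setT P)).
- by rewrite -(fine_measureK (probability_setT Q)).
congr fine; congr (_ _); apply/seteqP; split=> -[x y]; rewrite /W /=.
  by case=> -> -> -> ->.
by case=> -[-> ->] [-> ->].
Qed.

End ProductAction.

(** * Transfer of step functions between nearby pairs of actions *)

Section StepTransfer.
Context (R : realType) (G : groupType).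
Variables (P Q P' Q' : probability R R) (a b a' b' : G -> R -> R).
Hypotheses (mpa : is_mp_action R G _ R P a) (mpb : is_mp_action R G _ R Q b).
Hypotheses (mpa' : is_mp_action R G _ R P' a') (mpb' : is_mp_action R G _ R Q' b').
Variables (S : {fset G}) (k N : nat).

(** An entry is a sum of at most N^4 products of numbers in [0,1]; changing both factors by at most
    [e] changes each product by at most [2 * e]. *)
Lemma Mmat_step_lipschitz (g1 g2 g1' g2' : R -> 'I_N)
    (phi : 'I_N -> 'I_N -> 'I_k) (e : R) :
  meas_fin _ R N g1 -> meas_fin _ R N g2 ->
  meas_fin _ R N g1' -> meas_fin _ R N g2' -> 
  dist_inf R G S N (Mmat R G _ _ P a S N g1) (Mmat R G _ _ P' a' S N g1') <= e ->
  dist_inf R G S N (Mmat R G _ _ Q b S N g2) (Mmat R G _ _ Q' b' S N g2') <= e ->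
  dist_inf R G S k
    (Mmat R G _ _ (P \x Q)%E (prod_act G R R a b) S k (fun xy => phi (g1 xy.1) (g2 xy.2)))
    (Mmat R G _ _ (P' \x Q')%E (prod_act G R R a' b') S k (fun xy => phi (g1' xy.1) (g2' xy.2)))
  <= (2 * e) *+ #|{: ('I_N * 'I_N) * ('I_N * 'I_N)}|.
Proof.
move=> m1 m2 m1' m2' h1 h2.
have e0 : 0 <= e by apply: le_trans h1; apply: dist_ge0.
have e20 : 0 <= 2 * e by rewrite mulr_ge0.
apply: dist_le => [|g i j]; first by rewrite mulrn_wge0.
rewrite (Mmat_step mpa mpb phi g i j m1 m2) (Mmat_step mpa' mpb' phi g i j m1' m2').
rewrite -sumrB; apply: le_trans (ler_norm_sum _ _ _) _.
apply: (@le_trans _ _ (\sum_(t : ('I_N * 'I_N) * ('I_N * 'I_N)) 2 * e)); last first.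
  by rewrite sumr_const.
rewrite big_mkcond; apply: ler_sum => -[[u u'] [v v']] _ /=.
case: ifP => // _.
have := le_trans (entry_le_dist _ _ g u u') h1.
have := le_trans (entry_le_dist _ _ g v v') h2.
have := Mmat_unit_cube (probability_setT P) mpa m1 g u u'.
have := Mmat_unit_cube (probability_setT Q') mpb' m2' g v v'.
set x := Mmat _ _ _ _ P _ _ _ _ _ _ _; set y := Mmat _ _ _ _ Q _ _ _ _ _ _ _.
set x' := Mmat _ _ _ _ P' _ _ _ _ _ _ _; set y' := Mmat _ _ _ _ Q' _ _ _ _ _ _ _.
move=> /andP[y0 y1] /andP[x0 x1] hy hx.
have -> : x * y - x' * y' = x * (y - y') + (x - x') * y' by ring.
apply: le_trans (ler_normD _ _) _; rewrite !normrM (ger0_norm x0) (ger0_norm y0).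
rewrite mulr2n mulrDl !mul1r; apply: lerD.
  by apply: le_trans hy; rewrite ler_piMl.
by apply: le_trans hx; rewrite ler_piMr.
Qed.

End StepTransfer.

(** The radius [r] depends on [N] and [e] only. The two factor functions are replaced by functions
    for the other actions, and [phi] is kept. *)
Lemma step_transfer (R : realType) (G : groupType) (S : {fset G}) (k N : nat) (e : R) :
  (0 < N)%N -> 0 < e -> exists2 r, 0 < r & forall (A B A' B' : cls R G)
    (P Q P' Q' : probability R R) (a b a' b' : G -> R -> R),
  is_rep R G A P a -> is_rep R G B Q b -> is_rep R G A' P' a' -> is_rep R G B' Q' b' ->
  hdist R G S N (A S N) (A' S N) < r -> hdist R G S N (B S N) (B' S N) < r ->
  forall h, step_fun R k N h -> exists2 h', step_fun R k N h' &
    dist_inf R G S k (Mmat R G _ _ (P \x Q)%E (prod_act G R R a b) S k h)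
      (Mmat R G _ _ (P' \x Q')%E (prod_act G R R a' b') S k h') < e.
Proof.
move=> N0 e0; pose K := #|{: ('I_N * 'I_N) * ('I_N * 'I_N)}|.
(* Factor matrices will be [2 * r] apart, so the error is at most [4 * r * K], which is less than
   [5 * r * K.+1 = e]. *)
pose r := e / (5 * K.+1%:R).
have r0 : 0 < r by rewrite divr_gt0 // mulr_gt0.
exists r => // A B A' B' P Q P' Q' a b a' b'.
move=> [mpa [_ ->]] [mpb [_ ->]] [mpa' [_ ->]] [mpb' [_ ->]] hA hB h.
move=> [g1 [g2 [phi [m1 [m2 ->]]]]].
(* One [r] leads to a point of the other class, the second [r] realizes that point by a function. *)
have lift (P1 P2 : probability R R) (a1 a2 : G -> R -> R) (u : R -> 'I_N) :
    is_mp_action R G _ R P1 a1 -> is_mp_action R G _ R P2 a2 ->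
    hdist R G S N (clsof R G _ R P1 a1 S N) (clsof R G _ R P2 a2 S N) < r ->
    meas_fin _ R N u -> exists2 u', meas_fin _ R N u' &
    dist_inf R G S N (Mmat R G _ _ P1 a1 S N u) (Mmat R G _ _ P2 a2 S N u') <= 2 * r.
  move=> mp1 mp2 h12 mu.
  have := hdist_lt_exists (Cset_unit_cube (probability_setT P1) mp1 (k := N))
    (Cset_unit_cube (probability_setT P2) mp2 (k := N)) (Cset_nonempty P2 a2 S N0) h12
    (Mmat_Cset P1 a1 S mu).
  move=> [q Cq hq]; have [u' [mu' hu']] := Cq _ r0; exists u'; first exact: mu'.
  apply: le_trans (dist_triangle q _ _) _.
  by rewrite mulr2n mulrDl !mul1r lerD // ltW.
have [g1' m1' h1] := lift _ _ _ _ _ mpa mpa' hA m1.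
have [g2' m2' h2] := lift _ _ _ _ _ mpb mpb' hB m2.
exists (fun xy => phi (g1' xy.1) (g2' xy.2)); first by exists g1', g2', phi.
apply: le_lt_trans (Mmat_step_lipschitz mpa mpb mpa' mpb' phi m1 m2 m1' m2' h1 h2) _.
rewrite -mulr_natr -/K; have -> : e = 5 * r * K.+1%:R.
  by rewrite /r; field; rewrite addrC natr1 pnatr_eq0.
rewrite -natr1; have K0 : 0 <= K%:R :> R by [].
nra.
Qed.

(** * Random digits and the Cantor code *)

Section MeasureOfMassOne.
Context d (T : measurableType d) (R : realType) (mu : {measure set T -> \bar R}).
Hypothesis mu1 : mu setT = 1%E.

(** A measure renamed together with its proof of mass one, so that the probability structure can be
    attached to it. *)
Definition mass_one_measure of mu setT = 1%E : set T -> \bar R := mu.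
Local Notation P := (mass_one_measure mu1).

Let P0 : P set0 = 0%E. Proof. exact: measure0. Qed.
Let P_ge0 A : (0 <= P A)%E. Proof. exact: measure_ge0. Qed.
Let P_sigma_additive : semi_sigma_additive P.
Proof. exact: measure_semi_sigma_additive. Qed.

HB.instance Definition _ := isMeasure.Build _ _ _ P P0 P_ge0 P_sigma_additive.
HB.instance Definition _ := Measure_isProbability.Build _ _ _ P mu1.

Lemma exists_probability : exists P : probability T R, forall A, P A = mu A.
Proof. by exists P. Qed.

End MeasureOfMassOne.

Lemma measurable_ge_bool (R : realType) (c : R) :
  fibre_measurable (T := R) (fun u : R => c <= u).
Proof.
apply: fibre_measurable_bool; rewrite (_ : [set _ | _] = `[c, +oo[%classic).
  exact: measurable_itv.
by apply/seteqP; split=> u /=; rewrite in_itv /= andbT.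
Qed.

(** * Random bits with prescribed word probabilities *)

Section Digits.
Context (R : realType) (m : seq bool -> R).
Hypothesis m_ge0 : forall w, 0 <= m w.
Hypothesis m_nil : m [::] = 1.
Hypothesis m_rcons : forall w, m w = m (rcons w false) + m (rcons w true).

(* The words of length [n] cut [0, 1) into consecutive intervals of length [m w],
   in lexicographic order, and [word u n] is the word whose interval contains [u]. *)
Let left_end (w : seq bool) : R :=
  \sum_(i < size w) if nth false w i then m (rcons (take i w) false) else 0.

Fixpoint word (u : R) (n : nat) : seq bool :=
  if n is p.+1 then rcons (word u p) (left_end (word u p) + m (rcons (word u p) false) <= u)
  else [::].

Let left_end_rcons w b :
  left_end (rcons w b) = left_end w + if b then m (rcons w false) else 0.
Proof.
rewrite /left_end size_rcons big_ord_recr /= nth_rcons ltnn eqxx; congr (_ + _).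
  apply: eq_bigr => i _; rewrite nth_rcons ltn_ord.
  by rewrite -[in take _ _]cats1 takel_cat // ltnW.
by rewrite -[in take _ _]cats1 take_size_cat.
Qed.

Let word_bounds w : 0 <= left_end w /\ left_end w + m w <= 1.
Proof.
elim/last_ind: w => [|w b [l0 l1]]; first by rewrite /left_end big_ord0 m_nil add0r.
rewrite left_end_rcons; have := m_ge0 (rcons w false); have := m_ge0 (rcons w true).
by move: l1; rewrite (m_rcons w); case: b => l1 m1 m0; split; lra.
Qed.

(** Induction on the last letter: the next digit compares [u] with the point that cuts the interval
    of [w] into those of its two extensions. *)
Let word_interval w u : 0 <= u < 1 -> word u (size w) = w <->
  left_end w <= u < left_end w + m w.
Proof.
move=> u01; elim/last_ind: w => [|w b IH].
  by rewrite /left_end big_ord0 m_nil add0r u01.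
have := m_ge0 (rcons w false); have := m_ge0 (rcons w true); have := m_rcons w.
rewrite size_rcons left_end_rcons /= => mw m1 m0; split.
  move=> /eqP; rewrite eqseq_rcons => /andP[/eqP E]; move: (E) => /IH.
  rewrite E; case: b; first by rewrite eqb_id => /andP[? ?] ?; apply/andP; split; lra.
  by rewrite eqbF_neg -ltNge => /andP[? ?] ?; apply/andP; split; lra.
have [E|nE] := eqVneq (word u (size w)) w.
  rewrite E; case: b => /andP[? ?]; congr rcons; first by apply/idP; lra.
  by apply/negbTE; rewrite -ltNge; lra.
move=> h; case/eqP: nE; apply/IH.
by move: h; case: b => /andP[? ?]; apply/andP; split; lra.
Qed.

Let measurable_word n : fibre_measurable (T := measurableTypeR R) (word^~ n).
Proof.
elim: n => [|n IH] w.
  have [->|nw] := eqVneq w [::].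
    by rewrite (_ : _ @^-1` _ = setT) //; apply/seteqP; split.
  rewrite (_ : _ @^-1` _ = set0) //; apply/seteqP; split=> s //= h.
  by rewrite -h eqxx in nw.
case/lastP: w => [|w b].
  rewrite (_ : _ @^-1` _ = set0) //; apply/seteqP; split=> s //= /eqP.
  by rewrite -size_eq0 size_rcons.
rewrite (_ : _ @^-1` _ = (word^~ n) @^-1` [set w] `&`
   (fun u => left_end w + m (rcons w false) <= u) @^-1` [set b]).
  by apply: measurableI; [exact: IH|exact: (@measurable_ge_bool R _ b)].
apply/seteqP; split=> s /=; last by move=> [-> ->].
by move=> /eqP; rewrite eqseq_rcons => /andP[/eqP -> /eqP].
Qed.

(** The numbers [u] with initial word [w] fill an interval of length [m w], so under Lebesgue
    measure on [0,1) the digits have the prescribed joint law. *)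
Lemma exists_digits : exists (P : probability (measurableTypeR R) R) (digit : measurableTypeR R -> nat -> bool),
  (forall n, measurable [set u | digit u n]) /\
  forall w, fine_measure P [set u | mkseq (digit u) (size w) = w] = m w.
Proof.
pose I01 : set (measurableTypeR R) := `[0, 1[%classic.
have mI : measurable I01 := measurable_itv _.
pose mu : {measure set (measurableTypeR R) -> \bar R} := mrestr (@lebesgue_measure R) mI.
have [P PE] : exists P : probability (measurableTypeR R) R, forall A, P A = mu A.
  apply: exists_probability; rewrite /mu /= /mrestr setTI /I01 lebesgue_measure_itv /=.
  by rewrite lte_fin ltr01 oppr0 adde0.
(* Digit [n] is the letter that [word u n.+1] adds to [word u n]. *)
pose digit u n := last false (word u n.+1).
have wordE u n : mkseq (digit u) n = word u n.
  by elim: n => // n IH; rewrite mkseqS IH /digit /= last_rcons.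
exists P, digit; split=> [n|w].
  have size_word u k : size (word u k) == k.
    by apply/eqP; elim: k => //= k IH; rewrite size_rcons IH.
  pose W u : n.+1.-tuple bool := Tuple (size_word u n.+1).
  have mW : fibre_measurable W.
    move=> v; have := @measurable_word n.+1 v; congr (measurable _).
    by apply/seteqP; split=> s /= => [h|<- //]; apply: val_inj.
  exact: (fibre_measurable_preimage [set v : n.+1.-tuple bool | last false v] mW).
have [l0 l1] := word_bounds w; have m0 := m_ge0 w.
set D := [set u | _]; have -> : fine_measure P D = fine (mu D) by congr fine; apply: PE.
rewrite /mu /= /mrestr (_ : _ `&` _ = `[left_end w, left_end w + m w[%classic).
  rewrite lebesgue_measure_itv /= lte_fin; case: ltP => [_|h] /=; lra.
apply/seteqP; split=> u; rewrite /I01 /D /= !in_itv /= wordE.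
  by move=> [h u01]; apply/(word_interval w u01).
move=> h; have u01 : 0 <= u < 1 by move: h => /andP[? ?]; apply/andP; split; lra.
by split=> //; apply/(word_interval w u01).
Qed.

End Digits.

(** * Coding bit sequences by real numbers *)

Section CantorCode.
Context (R : realType).

Let partial (s : nat -> bool) (n : nat) : R := \sum_(i < n) 2 * (s i)%:R / 3 ^+ i.+1.

(* Reading a bit sequence as ternary digits 0 and 2 makes every bit recoverable by
   comparing with 1/2 the iterates of [y |-> 3 y - 2 bit]. *)
Definition ternary (s : nat -> bool) : R := limn (partial s).

(** The upper bound is the value when all digits are 2. *)
Let partial_bound s n : 0 <= partial s n <= 1 - 1 / 3 ^+ n.
Proof.
elim: n => [|n /andP[IH0 IH1]].
  by rewrite /partial big_ord0 expr0 divr1 subrr lexx.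
have p3 : 0 < (3 ^+ n)^-1 :> R by rewrite invr_gt0 exprn_gt0.
have e3 : (3 ^+ n.+1)^-1 = (3 ^+ n)^-1 / 3 :> R by rewrite exprSr invfM mulrC.
rewrite /partial big_ord_recr /= -/(partial s n) e3.
move: (3 ^+ n)^-1 p3 IH1 => x p3 IH1.
by case: (s n) => /=; rewrite ?mulr1n ?mulr0n; apply/andP; split; lra.
Qed.

Let partial_nondecreasing s : nondecreasing_seq (partial s).
Proof.
apply/nondecreasing_seqP => n; rewrite /partial big_ord_recr /= lerDl.
by rewrite divr_ge0 ?mulr_ge0 ?exprn_ge0.
Qed.

Let partial_cvg s : partial s @ \oo --> ternary s.
Proof.
apply: nondecreasing_is_cvgn; first exact: partial_nondecreasing.
exists 1 => _ [n _ <-]; have /andP[_ h] := partial_bound s n; apply: le_trans h _.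
by rewrite gerBl divr_ge0 ?exprn_ge0.
Qed.

Lemma ternary_bounds s : 0 <= ternary s <= 1.
Proof.
apply/andP; split.
  apply: limr_ge; first by apply/cvg_ex; exists (ternary s).
  by apply: nearW => n; case/andP: (partial_bound s n).
apply: limr_le; first by apply/cvg_ex; exists (ternary s).
apply: nearW => n; have /andP[_ h] := partial_bound s n; apply: le_trans h _.
by rewrite gerBl divr_ge0 ?exprn_ge0.
Qed.

Lemma ternary_shift s : ternary s = (2 * (s 0%N)%:R + ternary (s \o S)) / 3.
Proof.
have cv : (fun n => partial s n.+1) @ \oo --> ternary s.
  by rewrite (cvg_shiftS (partial s)); exact: partial_cvg.
suff cv' : (fun n => partial s n.+1) @ \oo --> (2 * (s 0%N)%:R + ternary (s \o S)) / 3.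
  exact: (cvg_unique _ cv cv').
have -> : (fun n => partial s n.+1) = (fun n => (2 * (s 0%N)%:R + partial (s \o S) n) / 3).
  apply/funext => n; rewrite /partial big_ord_recl /= expr1 [RHS]mulrDl; congr (_ + _).
  rewrite mulr_suml; apply: eq_bigr => i _ /=.
  by rewrite /bump /= add1n [3 ^+ i.+2]exprSr invfM mulrA.
apply: cvgMl; apply: cvgD; first exact: cvg_cst.
exact: partial_cvg.
Qed.

Fixpoint ternary_digit (y : R) (n : nat) : bool :=
  if n is p.+1 then ternary_digit (3 * y - 2 * (1 / 2 <= y)%R%:R) p else 1 / 2 <= y.

(** A leading bit 1 puts the code in [2/3, 1] and a leading bit 0 in [0, 1/3], so comparison with
    1/2 recovers it; by [ternary_shift] the remainder is the code of the shifted sequence. *)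
Lemma ternaryK : cancel ternary ternary_digit.
Proof.
move=> s; apply/funext => n.
have head s' : (1 / 2 <= ternary s') = s' 0%N.
  rewrite ternary_shift; have /andP[] := ternary_bounds (s' \o S).
  case: (s' 0%N) => ? ?; apply/idP => /=; first by lra.
  by apply/negP; rewrite -ltNge; lra.
elim: n s => [|n IH] s /=; first exact: head.
rewrite head [in 3 * _]ternary_shift (_ : _ - _ = ternary (s \o S)) ?IH //.
by field.
Qed.

Lemma measurable_ternary_digit n : measurable [set y | ternary_digit y n].
Proof.
have mh : measurable [set y : R | 1 / 2 <= y].
  exact: (fibre_measurable_preimage [set true] (measurable_ge_bool (1 / 2 : R))).
elim: n => //= n IH.
pose f (y : R) := 3 * y - 2 * (1 / 2 <= y)%R%:R.
have mf : measurable_fun setT f.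
  apply: measurable_funB; first exact: measurable_funM.
  apply: measurable_funM => //.
  rewrite (_ : (fun _ => _) = \1_[set y : R | 1 / 2 <= y]); first exact: measurable_indic.
  by apply/funext => y; rewrite indicE; congr ((nat_of_bool _)%:R); apply/idP/idP; rewrite inE.
by rewrite -[X in measurable X]setTI; exact: (mf measurableT _ IH).
Qed.

Lemma measurable_ternary d (T : measurableType d) (f : T -> nat -> bool) :
  (forall n, measurable [set t | f t n]) -> measurable_fun setT (ternary \o f).
Proof.
move=> mf; apply: (@measurable_fun_cvg _ _ _ _ (fun n t => partial (f t) n)).
  move=> n; apply: measurable_sum => i; apply: measurable_funM => //.
  apply: measurable_funM => //.
  rewrite (_ : (fun _ => _) = \1_[set t | f t i]); first exact: measurable_indic.
  by apply/funext => y; rewrite indicE; congr ((nat_of_bool _)%:R); apply/idP/idP; rewrite inE.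
by move=> t _; exact: partial_cvg.
Qed.

End CantorCode.

(** * Equipartitions of atomless measures *)

(** The sets are nested but not in the order of their indices. A finite union is still empty or one
    of the sets, so continuity from below applies to the finite unions. *)
Lemma fine_measure_chain d (T : measurableType d) (R : realType)
    (mu : {measure set T -> \bar R}) (A : nat -> set T) (t : R) :
  mu setT = 1%E -> 0 <= t -> (forall n, measurable (A n)) ->
  (forall i j, A i `<=` A j \/ A j `<=` A i) ->
  (forall n, fine_measure mu (A n) <= t) -> fine_measure mu (\bigcup_n A n) <= t.
Proof.
move=> mu1 t0 mA chain At; pose H n := \big[setU/set0]_(i < n) A i.
have mH n : measurable (H n) by apply: bigsetU_measurable.
have HA n : H n = set0 \/ exists i, H n = A i.
  elim: n => [|n [E|[i E]]]; first by left; rewrite /H big_ord0.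
    by right; exists n; rewrite /H big_ord_recr /= -/(H n) E set0U.
  right; rewrite /H big_ord_recr /= -/(H n) E.
  by have [/setUidr|/setUidl] := chain i n; [exists n|exists i].
have Ht n : (mu (H n) <= t%:E)%E.
  rewrite -fine_measureK // lee_fin.
  by have [->|[i ->]] := HA n; rewrite ?fine_measure0.
have HU : \bigcup_n A n = \bigcup_n H n.
  apply/seteqP; split=> [s [n _ An]|s [n _]].
    by exists n.+1 => //; rewrite /H big_ord_recr; right.
  by rewrite /H -bigcup_mkord => -[i _ Ai]; exists i.
have mU : measurable (\bigcup_n A n) by apply: bigcup_measurable.
rewrite -lee_fin fine_measureK // HU.
have cv : mu (H n) @[n --> \oo] --> mu (\bigcup_n H n).
  apply: nondecreasing_cvg_mu => //; first by rewrite -HU.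
  move=> i j ij; apply/subsetPset => s; rewrite /H -!bigcup_mkord => -[m /= mi Am].
  by exists m => //=; apply: leq_trans mi ij.
rewrite -(cvg_lim _ cv) //; apply: lime_le; first by apply/cvg_ex; exists (mu (\bigcup_n H n)).
exact: nearW.
Qed.

Section Atomless.
Context (R : realType) (P : probability R R).
Hypothesis atomless : forall x : R, P [set x] = 0%E.
Local Notation pr := (fine_measure P).

(** A Dedekind cut: [B] collects the rational left rays of mass at most [t], [B'] the right rays
    complementary to the other left rays. What remains has at most one point, so it is null and the
    mass of [B] is forced to be [t]. *)
Lemma atomless_lower_set (t : R) : 0 <= t <= 1 -> exists B : set R,
  [/\ measurable B, forall x y, y <= x -> B x -> B y & pr B = t].
Proof.
move=> /andP[t0 t1]; have P1 := probability_setT P.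
pose L (x : R) : set R := `]-oo, x]%classic; pose U (x : R) : set R := `]x, +oo[%classic.
have mL x : measurable (L x) by exact: measurable_itv.
have mU x : measurable (U x) by exact: measurable_itv.
have LU x : pr (L x) + pr (U x) = 1.
  rewrite -(fine_measureU P1) //.
    rewrite (_ : L x `|` U x = setT) ?fine_measureT //.
    apply/seteqP; split=> // y _; rewrite /L /U /= !in_itv /= andbT.
    by case: (leP y x); [left|right].
  apply/seteqP; split=> // y; rewrite /L /U /= !in_itv /= andbT => -[h].
  by rewrite ltNge h.
pose A n : set R := if (choice.unpickle n : option rat) is Some q then
  if pr (L (ratr q)) <= t then L (ratr q) else set0 else set0.
pose A' n : set R := if (choice.unpickle n : option rat) is Some q then
  if pr (L (ratr q)) <= t then set0 else U (ratr q) else set0.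
have mA n : measurable (A n) by rewrite /A; case: choice.unpickle => // q; case: ifP.
have mA' n : measurable (A' n) by rewrite /A'; case: choice.unpickle => // q; case: ifP.
pose B := \bigcup_n A n; pose B' := \bigcup_n A' n.
have mB : measurable B by apply: bigcup_measurable.
have mB' : measurable B' by apply: bigcup_measurable.
have Bt : pr B <= t.
  apply: fine_measure_chain => // [i j|n]; last first.
    by rewrite /A; case: choice.unpickle => [q|]; [case: ifP|]; rewrite ?fine_measure0.
  rewrite /A; case: choice.unpickle => [q|]; last by left.
  case: ifP => _; last by left.
  case: choice.unpickle => [q'|]; last by right.
  case: ifP => _; last by right.
  have [qq|/ltW qq] := leP (ratr q : R) (ratr q'); [left|right] => x;
    by rewrite /L /= !in_itv /= => h; apply: le_trans h qq.
have B't : pr B' <= 1 - t.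
  apply: fine_measure_chain => // [|i j|n]; first by rewrite subr_ge0.
    rewrite /A'; case: choice.unpickle => [q|]; last by left.
    case: ifP => _; first by left.
    case: choice.unpickle => [q'|]; last by right.
    case: ifP => _; first by right.
    have [qq|/ltW qq] := leP (ratr q' : R) (ratr q); [left|right] => x;
      by rewrite /U /= !in_itv /= !andbT => h; apply: le_lt_trans qq h.
  rewrite /A'; case: choice.unpickle => [q|]; last by rewrite fine_measure0 subr_ge0.
  case: ifP => [_|/negbT]; first by rewrite fine_measure0 subr_ge0.
  by rewrite -ltNge => h; have := LU (ratr q); lra.
have dB x y : y <= x -> B x -> B y.
  move=> yx [n _]; rewrite /A => h; exists n => //; move: h; rewrite /A.
  case: choice.unpickle => // q; case: ifP => // _; rewrite /L /= !in_itv /=.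
  exact: le_trans.
pose D := ~` (B `|` B').
have mD : measurable D by apply: measurableC; apply: measurableU.
have D0 : pr D = 0.
  have [[x Dx]|nD] := pselect (D !=set0); last first.
    rewrite (_ : D = set0) ?fine_measure0 //; apply/seteqP; split=> // x Dx.
    by apply: nD; exists x.
  suff -> : D = [set x] by exact: (congr1 fine (atomless x)).
  (* A rational between two points of [D] would put the smaller into [B] or the larger into [B']. *)
  have Dlt u v : D u -> D v -> ~ u < v.
    move=> Du Dv /rat_in_itvoo[q]; rewrite in_itv /= => /andP[uq qv].
    have [h|h] := boolP (pr (L (ratr q)) <= t).
      apply: Du; left; exists (choice.pickle q); [exact: I|rewrite /A choice.pickleK h].
      by rewrite /L /= in_itv /= ltW.
    apply: Dv; right; exists (choice.pickle q); [exact: I|rewrite /A' choice.pickleK].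
    by rewrite (negbTE h) /U /= in_itv /= qv.
  apply/seteqP; split=> [y Dy|_ -> //].
  by have [/(Dlt _ _ Dy Dx)|/(Dlt _ _ Dx Dy)|] := ltgtP y x.
exists B; split=> //; apply/eqP; rewrite eq_le Bt /=.
have : pr setT <= pr B + (pr B' + pr D).
  apply: le_trans (_ : _ <= pr B + pr (B' `|` D)) _.
    apply: (fine_measure_near P1) => //; first exact: measurableU.
    move=> x _; have [|nB] := pselect (B x); first by left.
    by have [|nB'] := pselect (B' x); right; [left|right; case].
  by rewrite lerD2l; apply: fine_measureU_le.
by rewrite fine_measureT // D0; lra.
Qed.

(** Lower sets of masses j/k are increasing; [f] sends a point to the first step at which it is
    caught, so its level sets are successive differences up to a null set. *)
Lemma atomless_equipartition k : (0 < k)%N -> exists2 f : R -> 'I_k,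
  meas_fin _ R k f & forall i, pr (f @^-1` [set i]) <= k%:R^-1.
Proof.
case: k => // k _; have P1 := probability_setT P.
have k0 : 0 < k.+1%:R :> R by [].
(* Index 0 gets the empty set itself, since a lower set of mass zero could still contain points. *)
have /choice[B hB] : forall j, exists B : set R, (j <= k.+1)%N ->
    [/\ measurable B, forall x y, y <= x -> B x -> B y,
        pr B = j%:R / k.+1%:R & j = 0%N -> B = set0].
  move=> j.
  have [jk|nj] := leqP j k.+1; last by exists set0.
  case: j jk => [|j] jk; first by exists set0; rewrite fine_measure0 mul0r.
  have [|A [mA dA pA]] := @atomless_lower_set (j.+1%:R / k.+1%:R).
    by rewrite divr_ge0 //= ler_pdivrMr // mul1r ler_nat.
  by exists A.
pose ev (j : 'I_k.+1) (x : R) := `[< B j.+1 x >].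
have mev j : measurable [set x | ev j x].
  rewrite (_ : [set _ | _] = B j.+1); first by case: (hB j.+1 (ltn_ord j)).
  by apply/seteqP; split=> x /asboolP.
(* A point outside every set has [find] equal to [k.+1], which [inord] turns into 0; these points
   form the null set [N] below. *)
pose f x : 'I_k.+1 := inord (find id [seq ev i x | i <- enum 'I_k.+1]).
exists f; first exact: (fibre_measurable_sees _ (fun w => inord (find id w)) mev).
move=> i; have [mi di pi i0] := hB i (ltnW (ltn_ord i)).
have [mi1 di1 pi1 _] := hB i.+1 (ltn_ord i).
have evE (j : 'I_k.+1) x : nth false [seq ev i x | i <- enum 'I_k.+1] j = ev j x.
  by rewrite (nth_map ord0) ?size_enum_ord // nth_ord_enum.
have pB : pr (B k.+1) = 1 by have [_ _ -> _] := hB k.+1 (leqnn _); rewrite divff // gt_eqF.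
(* Lower sets are comparable, and the opposite inclusion would contradict their masses. *)
have inc : B i `<=` B i.+1.
  move=> x Bx; apply: contrapT => nBx.
  have : pr (B i.+1) <= pr (B i).
    apply: (fine_measure_le P1) => // y By; apply: di Bx; rewrite leNgt.
    by apply/negP => /ltW xy; apply: nBx; apply: di1 By.
  by rewrite pi pi1 ler_pM2r ?invr_gt0 // ler_nat ltnn.
have mdiff : measurable (B i.+1 `\` B i) by apply: measurableD.
have prdiff : pr (B i.+1 `\` B i) = k.+1%:R^-1.
  have := fine_measureU P1 mi mdiff.
  rewrite setDE setUIr setUv setIT (setUidr inc) setICA setICr setI0 => /(_ erefl).
  by rewrite pi pi1 -natr1 mulrDl mul1r => /addrI.
pose N := ~` B k.+1.
have [mk _ _ _] := hB k.+1 (leqnn _).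
have mN : measurable N by apply: measurableC.
have N0 : pr N = 0.
  have := fine_measureU P1 mk mN; rewrite setUv setICr fine_measureT // pB => /(_ erefl).
  lra.
rewrite -prdiff -[leRHS]addr0 -N0; apply: (fine_measure_near P1) => //.
  exact: (fibre_measurable_sees _ (fun w => inord (find id w)) mev).
move=> x /= fx; have [Bk|] := pselect (B k.+1 x); last by right.
left; have hhas : has id [seq ev i x | i <- enum 'I_k.+1].
  apply/(has_nthP false); exists k; first by rewrite size_map size_enum_ord.
  by rewrite (evE ord_max); apply/asboolP.
have fi : find id [seq ev i x | i <- enum 'I_k.+1] = i.
  move: (hhas); rewrite has_find size_map size_enum_ord => lt.
  by have := congr1 val fx; rewrite /f /= inordK.
split.
  by have := nth_find false hhas; rewrite fi evE => /asboolP.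
have [/i0 -> //|i_gt0] := posnP i; move=> Bi.
have ik : (i.-1 < k.+1)%N by apply: leq_ltn_trans (leq_pred _) (ltn_ord i).
have := @before_find _ false id [seq ev i x | i <- enum 'I_k.+1] i.-1.
rewrite fi prednK // leqnn (evE (Ordinal ik)) /ev /= prednK // => /(_ isT).
by move=> /asboolP.
Qed.

End Atomless.

(** * Limit of itinerary measures along an ultrafilter *)

Lemma exists_image_probability d d' (T : measurableType d) (T' : measurableType d')
    (R : realType) (P : probability T R) (f : T -> T') : measurable_fun setT f ->
  exists Q : probability T' R, forall A, Q A = P (f @^-1` A).
Proof.
move=> mf; pose F : {mfun T >-> T'} := HB.pack f (isMeasurableFun.Build _ _ _ _ _ mf).
by exists (distribution P F).
Qed.

(** The limit is the supremum of the [x] with [x <= u n] for [U]-almost all [n]; for larger values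
    the ultrafilter must contain the complement. *)
Lemma ultra_cvg (R : realType) (I : Type) (U : set_system I) (u : I -> R) :
  UltraFilter U -> (forall n, 0 <= u n <= 1) -> cvg (u n @[n --> U]).
Proof.
move=> UU u01; pose X := [set x : R | U [set n | x <= u n]].
have X0 : X 0 by apply: filterS filterT => n _; case/andP: (u01 n).
have Xub : has_ubound X.
  exists 1 => x Ux; have [n xn] := filter_ex Ux.
  by case/andP: (u01 n) => _; apply: le_trans.
apply/cvg_ex; exists (sup X); apply/cvgrPdist_lt => e e0.
have [x Ux xl] : exists2 x, X x & sup X - e < x.
  by apply: sup_adherent => //; split; [exists 0|].
have h : U (~` [set n | sup X + e <= u n]).
  have [Ue|//] := in_ultra_setVsetC [set n | sup X + e <= u n] UU.
  by have := ub_le_sup Xub Ue; rewrite gerDl leNgt e0.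
apply: filterS2 Ux h => n /= xn /negP; rewrite -ltNge => nl.
by rewrite ltr_distl; apply/andP; split; lra.
Qed.

Section LimitAction.
Context (R : realType) (G : groupType) (L : eqType).
Variables (enum : nat -> L * G) (code : L * G -> nat).
Hypothesis codeK : cancel code enum.
Variables (P : nat -> probability R R) (a : nat -> G -> R -> R).
Hypothesis mp : forall n, is_mp_action R G _ R (P n) (a n).
Variable E : L -> nat -> R -> bool.
Hypothesis mE : forall l n, measurable [set x | E l n x].
Variable U : set_system nat.
Hypothesis UU : UltraFilter U.

(** The itinerary of [x] under the action of index [n]: coordinate [(l, h)] tells whether the
    translate of [x] by [h] satisfies the event labelled [l]. *)
Definition trace n (x : R) (i : L * G) : bool := E i.1 n (a n i.2 x).

Lemma measurable_trace n i : measurable [set x | trace n x i].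
Proof.
have [ma _] := (mp n).2 i.2; rewrite -[X in measurable X]setTI.
exact: (ma measurableT _ (mE i.1 n)).
Qed.

Definition coordinate_sets : set (set (L * G -> bool)) :=
  [set [set s : L * G -> bool | s i] | i in setT].
Local Notation Omega := (g_sigma_algebraType coordinate_sets).

(** Right multiplication of the index gives a left action, and it makes [trace n] equivariant. *)
Definition coord_shift (g : G) (s : Omega) : Omega := fun i => s (i.1, mul i.2 g).

Lemma trace_shift n g x : trace n (a n g x) = coord_shift g (trace n x).
Proof.
apply/funext => -[l h]; rewrite /trace /coord_shift /=.
by rewrite (mp n).1.2.
Qed.

Let ev (i : L * G) (s : Omega) : bool := s i.

Lemma measurable_coordinate i : measurable [set s : Omega | s i].
Proof. by apply: sub_sigma_algebra; exists i. Qed.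

Lemma coordinate_generate (A : set Omega) : measurable A ->
  <<s [set [set s : Omega | s i] | i in setT] >> A.
Proof. by []. Qed.

Lemma measurable_pattern_fun d (T : measurableType d) (f : T -> Omega) :
  (forall i, measurable [set t | f t i]) -> measurable_fun setT f.
Proof.
move=> mf; apply: (@measurability _ _ T Omega setT f coordinate_sets) => //.
by move=> _ [_ [i _ <-] <-]; rewrite setTI; exact: mf.
Qed.

Let word_mass n (w : seq bool) : R :=
  fine_measure (P n) [set x | mkseq (trace n x \o enum) (size w) = w].

Let measurable_trace_word n (w : seq bool) :
  measurable [set x | mkseq (trace n x \o enum) (size w) = w].
Proof.
have mev i : measurable [set x | trace n x (enum i)] by exact: measurable_trace.
exact: (fibre_measurable_map (iota 0 (size w)) mev).
Qed.

Let word_mass_cvg w : cvg (word_mass n w @[n --> U]).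
Proof.
apply: ultra_cvg => n; rewrite fine_measure_ge0.
by rewrite (fine_measure_le1 (probability_setT (P n))).
Qed.

(** Limits of word masses are again consistent, so they are the law of random digits. An event on
    the coordinates in [J] is a finite union of words of one length, and finite sums commute with
    the limit. *)
Lemma exists_limit_measure : exists lambda : probability Omega R,
  forall (J : seq (L * G)) (phi : seq bool -> bool),
  fine_measure (P n) [set x | phi [seq trace n x i | i <- J]] @[n --> U]
    --> fine_measure lambda [set s | phi [seq s i | i <- J]].
Proof.
pose m w := lim (word_mass n w @[n --> U]).
have m_ge0 w : 0 <= m w.
  by apply: limr_ge => //; apply: nearW => n; exact: fine_measure_ge0.
have m_nil : m [::] = 1.
  rewrite /m (_ : word_mass^~ [::] = cst 1); first exact: lim_cst.
  apply/funext => n; rewrite /word_mass (_ : [set _ | _] = setT).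
    exact: (fine_measureT (probability_setT (P n))).
  by apply/seteqP; split.
have m_rcons w : m w = m (rcons w false) + m (rcons w true).
  rewrite /m -limD //; congr (lim (_ @ U)); apply/funext => n.
  transitivity (word_mass n (rcons w false) + word_mass n (rcons w true)) => //.
  rewrite /word_mass -(fine_measureU (probability_setT (P n))) //.
    congr fine_measure; apply/seteqP; split=> x /=; rewrite !size_rcons mkseqS.
      by move=> -> /=; case: (trace n x (enum (size w))); [right|left].
    by case=> /eqP; rewrite eqseq_rcons => /andP[/eqP].
  apply/seteqP; split=> // x [] /=; rewrite !size_rcons => -> /eqP.
  by rewrite eqseq_rcons andbF.
have [P0 [digit [mdigit digitE]]] := exists_digits m_ge0 m_nil m_rcons.
have P01 := probability_setT P0.
(* Coordinate [i] is read at position [code i]; digits at positions outside the range of [code] are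
   dropped. *)
pose f (u : measurableTypeR R) : Omega := fun i => digit u (code i).
have mf : measurable_fun setT f.
  by apply: measurable_pattern_fun => i; exact: mdigit.
have [lambda lambdaE] := exists_image_probability P0 mf.
exists lambda => J phi.
pose N := (\max_(i <- J) code i).+1.
pose phi' (v : N.-tuple bool) := phi [seq nth false v (code i) | i <- J].
pose W d (T : measurableType d) (b : nat -> T -> bool) (t : T) :=
  [tuple of [seq b i t | i <- [tuple of iota 0 N]]].
have mW d (T : measurableType d) (b : nat -> T -> bool) :
    (forall i, measurable [set t | b i t]) -> fibre_measurable (W d T b).
  move=> mb v; have := fibre_measurable_map (iota 0 N) mb v; congr (measurable _).
  by apply/seteqP; split=> s /= => [h|<- //]; apply: val_inj.
have phiE d (T : measurableType d) (b : nat -> T -> bool) t :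
    phi [seq b (code i) t | i <- J] = phi' (W d T b t).
  rewrite /phi'; congr phi; apply/eq_in_map => i iJ.
  have iN : (code i < N)%N by rewrite ltnS; apply: leq_bigmax_seq.
  by rewrite (nth_map 0%N) ?size_iota // nth_iota.
have WE d (T : measurableType d) (b : nat -> T -> bool) (v : N.-tuple bool) :
    W d T b @^-1` [set v] = [set t | mkseq (b^~ t) (size v) = v].
  apply/seteqP; split=> t /=; rewrite size_tuple => h; last exact: val_inj.
  by rewrite -h.
have -> : fine_measure lambda [set s | phi [seq s i | i <- J]] =
    \sum_(v | phi' v) m v.
  transitivity (fine_measure P0 [set u | phi' (W _ _ (fun j u => digit u j) u)]).
    rewrite /fine_measure; congr fine; apply: (etrans (lambdaE _)).
    by congr (P0 _); apply/seteqP; split=> u /=; rewrite -phiE.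
  rewrite (fine_measure_sum P01) //; last exact: mW.
  by apply: eq_bigr => v _; rewrite WE digitE.
have -> : (fun n => fine_measure (P n) [set x | phi [seq trace n x i | i <- J]]) =
    (fun n => \sum_(v | phi' v) word_mass n v).
  apply/funext => n; pose b j x := trace n x (enum j).
  have -> : [set x | phi [seq trace n x i | i <- J]] = [set x | phi' (W _ _ b x)].
    apply/seteqP; split=> x /=; rewrite -phiE; congr (is_true (phi _));
      by apply: eq_map => i; rewrite /b codeK.
  rewrite (fine_measure_sum (probability_setT (P n))).
    by apply: eq_bigr => v _; rewrite WE.
  by apply: mW => j; exact: measurable_trace.
by apply: cvg_big => [|v _]; [exact: add_continuous|exact: word_mass_cvg].
Qed.

Variable lambda : probability Omega R.
Hypothesis lambda_lim : forall (J : seq (L * G)) (phi : seq bool -> bool),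
  fine_measure (P n) [set x | phi [seq trace n x i | i <- J]] @[n --> U]
    --> fine_measure lambda [set s : Omega | phi [seq s i | i <- J]].

Let translate (g : G) (J : seq (L * G)) := [seq (i.1, mul i.2 g) | i <- J].

(** Translating the coordinates of a finite pattern does not change its mass under any [P n], hence
    not in the limit; the finite patterns form a generating system closed under intersection. *)
Lemma shift_mp_action : is_mp_action R G _ Omega lambda coord_shift.
Proof.
have mshift g : measurable_fun setT (coord_shift g).
  by apply: measurable_pattern_fun => i; exact: measurable_coordinate.
split; first split.
- by move=> s; apply/funext => -[l h]; rewrite /coord_shift /= mulg1.
- by move=> g h s; apply/funext => -[l h']; rewrite /coord_shift /= mulgA.
move=> g; split=> // A mA.
have [lambda' lambda'E] := exists_image_probability lambda (mshift g).
apply: etrans (esym (lambda'E A)) _.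
pose H : set (set Omega) :=
  [set B | exists J (phi : seq bool -> bool), B = [set s : Omega | phi [seq s i | i <- J]]].
have mH : H `<=` measurable.
  move=> _ [J [phi ->]].
  exact: (fibre_measurable_sees J phi (ev := ev) measurable_coordinate true).
apply: (measure_unique H (fun=> setT)) => //.
- apply/seteqP; split.
    apply: smallest_sub; first exact: smallest_sigma_algebra.
    move=> _ [i _ <-]; apply: sub_sigma_algebra; exists [:: i], (head false).
    by apply/seteqP; split.
  by apply: smallest_sub => //; exact: sigma_algebra_measurable.
- move=> _ _ [J [phi ->]] [K [psi ->]].
  exists (J ++ K), (fun w => phi (take (size J) w) && psi (drop (size J) w)).
  apply/seteqP; split=> s /=; rewrite map_cat take_size_cat ?size_map //
    drop_size_cat ?size_map //; first by case=> -> ->.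
  by case/andP.
- by move=> _; exists [::], xpredT; apply/seteqP; split.
- by rewrite bigcup_const.
- move=> _ [J [phi ->]]; apply: etrans (lambda'E _) _.
  set B := [set s : Omega | _].
  have mB : measurable B by apply: mH; exists J, phi.
  have mgB : measurable (coord_shift g @^-1` B).
    by rewrite -[X in measurable X]setTI; exact: mshift.
  rewrite -(fine_measureK (probability_setT lambda) mB).
  rewrite -(fine_measureK (probability_setT lambda) mgB); congr EFin.
  have := @lambda_lim (translate g J) phi.
  have -> : [set s : Omega | phi [seq s i | i <- translate g J]] = coord_shift g @^-1` B.
    by apply/seteqP; split=> s; rewrite /B /= /translate -map_comp.
  have -> : (fun n => fine_measure (P n) [set x | phi [seq trace n x i | i <- translate g J]]) =
      (fun n => fine_measure (P n) [set x | phi [seq trace n x i | i <- J]]).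
    apply/funext => n; rewrite /fine_measure; congr fine.
    rewrite -[RHS]((mp n).2 g).2; last first.
      exact: (fibre_measurable_sees J phi (ev := fun i x => trace n x i) (measurable_trace n) true).
    congr (P n _); apply/seteqP; split=> x; rewrite /= trace_shift /translate -map_comp //.
  by move=> /cvg_unique; apply => //; exact: lambda_lim.
- by move=> _; rewrite (le_lt_trans (probability_le1 _ _)) ?ltry.
Qed.

(** A joint event reads [J] and its translate, so it is again a finite pattern and its mass
    converges. There are finitely many entries, so [U] controls them together. *)
Lemma Mmat_limit (S : {fset G}) k (J : seq (L * G)) (psi : seq bool -> 'I_k) (e : R) :
  0 < e -> U [set n | dist_inf R G S k
    (Mmat R G _ Omega lambda coord_shift S k (fun s => psi [seq s i | i <- J]))
    (Mmat R G _ R (P n) (a n) S k (fun x => psi [seq trace n x i | i <- J])) < e].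
Proof.
move=> e0; have e20 : 0 < e / 2 by rewrite divr_gt0.
have entry (t : S * 'I_k * 'I_k) : U [set n | `|
    Mmat R G _ Omega lambda coord_shift S k (fun s => psi [seq s i | i <- J]) t.1.1 t.1.2 t.2 -
    Mmat R G _ R (P n) (a n) S k (fun x => psi [seq trace n x i | i <- J]) t.1.1 t.1.2 t.2|
    < e / 2].
  case: t => -[g i] j /=.
  pose phi w := (psi (take (size J) w) == i) && (psi (drop (size J) w) == j).
  have := @lambda_lim (J ++ translate (val g) J) phi.
  move=> /cvgrPdist_lt /(_ _ e20); apply: filterS => n.
  rewrite /fine_measure /Mmat; apply: etrans; congr (`|fine _ - fine _| < _).
    congr (lambda _); apply/seteqP; split=> s /=; rewrite /phi map_cat
      take_size_cat ?size_map // drop_size_cat ?size_map // /translate -map_comp.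
      by case=> -> ->; rewrite !eqxx.
    by case/andP => /eqP ? /eqP ?.
  congr (P n _); apply/seteqP; split=> x /=; rewrite /phi map_cat
    take_size_cat ?size_map // drop_size_cat ?size_map // /translate -map_comp trace_shift.
    by case=> -> ->; rewrite !eqxx.
  by case/andP => /eqP ? /eqP ?.
apply: filterS (filter_forall _ entry) => n h.
apply: le_lt_trans (_ : _ <= e / 2) _; last by lra.
by apply: dist_le => [|g i j]; [exact: ltW|exact: (ltW (h (g, i, j)))].
Qed.

End LimitAction.

(** * Compactness of the space of classes *)

(** The measure is pushed to the line along [f], and the action is transported to the image and
    extended by the identity. The image is measurable, being the set of fixed points of [f \o g]. *)
Lemma exists_real_model (R : realType) (G : groupType) d (T : measurableType d)
    (lambda : probability T R) (a : G -> T -> T) (f : T -> R) (g : R -> T) :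
  is_mp_action R G d T lambda a -> measurable_fun setT f -> measurable_fun setT g ->
  cancel f g -> exists (P : probability R R) (b : G -> R -> R),
    is_mp_action R G _ R P b /\
    forall S k, Cset R G _ R P b S k = Cset R G d T lambda a S k.
Proof.
move=> mp mf mg fK; have [P PE] := exists_image_probability lambda mf.
pose b h y := if f (g y) == y then f (a h (g y)) else y.
have bf h s : b h (f s) = f (a h s) by rewrite /b fK eqxx.
have mpb : is_mp_action R G _ R P b.
  split; first split.
  - by move=> y; rewrite /b; case: eqP => // fgy; rewrite mp.1.1.
  - move=> h h' y; rewrite {1 3}/b; case: eqP => fgy; last first.
      by rewrite /b; case: eqP.
    by rewrite bf mp.1.2.
  move=> h; have [mah ah] := mp.2 h.
  have mfg : measurable_fun setT (f \o g) by apply: measurableT_comp.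
  have mb : measurable_fun setT (b h).
    apply: measurable_fun_ifT => //; last by do 2!apply: measurableT_comp => //.
    apply: (measurable_fun_bool true); rewrite setTI.
    rewrite (_ : _ @^-1` _ = (f \o g \- id) @^-1` [set 0]).
      rewrite -[X in measurable X]setTI.
      by apply: (measurable_funB mfg (@measurable_id _ _ setT)) => //.
    apply/seteqP; split=> y /=; first by move=> /eqP ->; rewrite subrr.
    by move=> fg0; rewrite -subr_eq0 fg0 eqxx.
  split=> // A mA.
  apply: etrans (PE _) _; apply: etrans _ (esym (PE _)).
  rewrite -[RHS]ah; last by rewrite -[X in measurable X]setTI; exact: mf.
  by congr (lambda _); apply/seteqP; split=> s; rewrite /= bf.
exists P, b; split=> // S k.
apply: (Cset_isomorphic S k mpb mf mg fK) => [x h|A _]; last exact: PE.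
by rewrite bf.
Qed.

(** * Limits of actions and of classes along an ultrafilter *)

Section LimitClass.
Context (R : realType) (G : groupType).
Hypothesis G_countable : countable [set: G].
Variables (P : nat -> probability R R) (a : nat -> G -> R -> R).
Hypothesis mp : forall n, is_mp_action R G _ R (P n) (a n).
Variable U : set_system nat.
Hypothesis UU : UltraFilter U.

(* The label (S, k, q, r, i) names the level set at i of the r-th function in a
   finite family whose matrices form a 2/(q+1)-net of C_{S,k}; the size of the
   family depends on S, k and q only, not on the action. *)
Let label : eqType := ({fset G} * nat * nat * (nat * nat))%type.

Let exists_label_code : exists (enum : nat -> label * G) (code : label * G -> nat),
  cancel code enum.
Proof.
have [c cinj] : exists c : G -> nat, injective c.
  have /countable_injP[c hc] := G_countable.
  by exists c => x y; apply: hc; rewrite inE.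
(* A finite subset of [G] is coded by the list of the codes of its elements. *)
pose c' (i : label * G) : nat := choice.pickle
  ([seq c x | x <- enum_fset i.1.1.1.1], i.1.1.1.2, i.1.1.2, i.1.2, c i.2).
have c'inj : injective c'.
  move=> [[[[S k] q] ri] g] [[[[S' k'] q'] ri'] g'] /(pcan_inj choice.pickleK) /=.
  move=> [/(inj_map cinj) SS -> -> -> /cinj ->].
  by have -> : S = S' by exact: val_inj SS.
pose i0 : label * G := ((fset0, 0, 0, (0, 0)), one)%N.
pose e n : label * G := if pselect (exists i, c' i = n) is left h then projT1 (cid h) else i0.
exists e, c' => i; rewrite /e; case: pselect => [h|[]]; last by exists i.
by case: cid => j /= /c'inj.
Qed.

(** One [1/(q+1)] is the mesh of the net, the other the error of realizing its points by functions.
    The functions are recorded with values in [nat], so that one family [F] covers all [k]. *)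
Let exists_nets : exists (m : {fset G} -> nat -> nat -> nat)
    (F : nat -> {fset G} -> nat -> nat -> nat -> R -> nat),
  (forall n S k q r i, measurable [set x | F n S k q r x == i]) /\
  forall n S k q, (0 < k)%N -> exists f : nat -> R -> 'I_k,
    [/\ forall r, meas_fin _ R k (f r), forall r x, f r x = F n S k q r x :> nat &
     forall p, Cset R G _ R (P n) (a n) S k p -> exists2 r, (r < m S k q)%N &
       dist_inf R G S k p (Mmat R G _ R (P n) (a n) S k (f r)) <= 2 / q.+1%:R].
Proof.
have q0 q : 0 < q.+1%:R^-1 :> R by rewrite invr_gt0.
have /choice[m hm] : forall t : {fset G} * nat * nat, exists m, _ :=
  fun t => @unit_cube_net R G t.1.1 t.1.2 _ (q0 t.2).
pose good (t : nat * {fset G} * nat * nat) (F : nat -> R -> nat) :=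
  (forall r i, measurable [set x | F r x == i]) /\
  ((0 < t.1.2)%N -> exists f : nat -> R -> 'I_t.1.2,
    [/\ forall r, meas_fin _ R t.1.2 (f r), forall r x, f r x = F r x :> nat &
     forall p, Cset R G _ R (P t.1.1.1) (a t.1.1.1) t.1.1.2 t.1.2 p ->
       exists2 r, (r < m (t.1.1.2, t.1.2, t.2))%N &
       dist_inf R G t.1.1.2 t.1.2 p
         (Mmat R G _ R (P t.1.1.1) (a t.1.1.1) t.1.1.2 t.1.2 (f r)) <= 2 / t.2.+1%:R]).
have /choice[F hF] : forall t, exists F, good t F.
  move=> [[[n S] k] q]; rewrite /good /=.
  have [k0|k0] := posnP k.
    exists (fun _ _ => 0%N); split=> [r i|]; last by rewrite k0.
    rewrite (_ : [set _ | _] = if 0%N == i then setT else set0); first by case: ifP.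
    by case: ifP => i0; apply/seteqP; split=> x; rewrite //= i0.
  have Pn1 := probability_setT (P n).
  have [x Cx hx] := hm (S, k, q) _ (Cset_unit_cube Pn1 (mp n) (k := k))
    (Cset_nonempty (P n) (a n) S k0).
  have /choice[f hf] := fun r => Cx r _ (q0 q).
  exists (fun r x => f r x); split=> [r i|_].
    have mf := (hf r).1.
    exact: (fibre_measurable_preimage [set u : 'I_k | nat_of_ord u == i] mf).
  exists f; split=> // [r|p /hx[r rm pr]]; first exact: (hf r).1.
  exists r => //; apply: le_trans (dist_triangle (x r) _ _) _.
  by rewrite mulr2n mulrDl !mul1r lerD // ltW // (hf r).2.
exists (fun S k q => m (S, k, q)), (fun n S k q => F (n, S, k, q)).
split=> [n S k q|n S k q k0]; first exact: (hF (n, S, k, q)).1.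
exact: (hF (n, S, k, q)).2.
Qed.

(** Both halves of the Hausdorff distance come from [Mmat_limit]: the net functions of each action
    can be read from the itinerary, and any function on the shift space is nearly a function of
    finitely many coordinates, which can be evaluated on traces. *)
Lemma exists_limit_action : exists (P' : probability R R) (a' : G -> R -> R),
  is_mp_action R G _ R P' a' /\ forall S k (e : R), (0 < k)%N -> 0 < e ->
    U [set n | hdist R G S k (Cset R G _ R P' a' S k)
                 (Cset R G _ R (P n) (a n) S k) < e].
Proof.
have [enum [code codeK]] := exists_label_code.
have [m [F [mF hF]]] := exists_nets.
pose E (l : label) n x := F n l.1.1.1 l.1.1.2 l.1.2 l.2.1 x == l.2.2.
have mE l n : measurable [set x | E l n x] by exact: mF.
have [lambda lim] := exists_limit_measure codeK mp mE UU.
have mpL := shift_mp_action mp mE UU lim.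
have FU : Filter U by exact: filter_filter.
have L1 := probability_setT lambda.
have [P' [a' [mp' CE]]] : exists (P' : probability R R) (a' : G -> R -> R),
    is_mp_action R G _ R P' a' /\
    forall S k, Cset R G _ R P' a' S k = Cset R G _ _ lambda (@coord_shift G label) S k.
  pose Omega := g_sigma_algebraType (@coordinate_sets G label).
  pose f (s : Omega) : R := ternary R (s \o enum).
  pose g (y : R) : Omega := ternary_digit y \o code.
  apply: (exists_real_model (f := f) (g := g) mpL).
  - by apply: measurable_ternary => n; exact: (@measurable_coordinate G label).
  - by apply: measurable_pattern_fun => i; exact: measurable_ternary_digit.
  - by move=> s; apply/funext => i; rewrite /g /= ternaryK /= codeK.
exists P', a'; split=> // S k e k0 e0; rewrite CE.
set C := Cset _ _ _ _ lambda _ _ _; pose C' n := Cset R G _ R (P n) (a n) S k.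
pose Omega := g_sigma_algebraType (@coordinate_sets G label).
pose word (J : seq (label * G)) (s : Omega) := [seq s i | i <- J].
pose ML (f : Omega -> 'I_k) := Mmat R G _ Omega lambda (@coord_shift G label) S k f.
have C_ML J (psi : seq bool -> 'I_k) : C (ML (psi \o word J)).
  apply: Mmat_Cset => i; pose ev (i : label * G) (s : Omega) := s i.
  exact: (fibre_measurable_sees J psi (ev := ev) (@measurable_coordinate G label)).
pose M' n f := Mmat R G _ R (P n) (a n) S k f.
have e60 : 0 < e / 6 by rewrite divr_gt0.
have into_limit : U [set n | forall p, C' n p -> exists2 q, C q &
    dist_inf R G S k q p <= e / 2].
  have [q hq] : exists q : nat, 2 / q.+1%:R <= e / 6 :> R.
    exists (Num.bound (12 / e)); rewrite ler_pdivrMr // -ler_pdivrMl //.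
    rewrite (_ : _ * 2 = 12 / e); last by field; rewrite gt_eqF.
    have ge0 : 0 <= 12 / e by rewrite divr_ge0 // ltW.
    by apply: le_trans (ltW (archi_boundP ge0)) _; rewrite ler_nat.
  (* The [r]-th net function is read off at the unit of [G]: its level sets are the [k] labels in
     [J r], and [psi] returns the index of the true bit. *)
  pose J r : seq (label * G) := [seq ((S, k, q, (r, i)), one) | i <- iota 0 k].
  pose psi (w : seq bool) : 'I_k := odflt (Ordinal k0) [pick i : 'I_k | nth false w i].
  (* The number of net functions does not depend on [n], so finitely many sets of [U] are
     intersected. *)
  have near_net := filter_forall FU (fun r : 'I_(m S k q) =>
    Mmat_limit mp UU lim S (J r) psi e60).
  apply: filterS near_net => n near p Cp.
  have [f [mf fE net]] := hF n S k q k0; have [r rm pr] := net p Cp.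
  have traceE x : psi [seq trace a E n x i | i <- J r] = f r x.
    have nthE (i : 'I_k) : nth false [seq trace a E n x i | i <- J r] i = (f r x == i).
      rewrite -map_comp (nth_map 0%N) ?size_iota // nth_iota //= add0n.
      by rewrite /trace /E /= (mp n).1.1 -fE.
    rewrite /psi; case: pickP => [i|/(_ (f r x))]; rewrite nthE; first by move/eqP.
    by rewrite eqxx.
  exists (ML (psi \o word (J r))); first exact: C_ML.
  apply: le_trans (dist_triangle (M' n (f r)) _ _) _.
  have := near (Ordinal rm); rewrite /= (_ : (fun x => _) = f r); last first.
    by apply/funext => x; exact: traceE.
  rewrite [dist_inf _ _ _ _ (M' n _) _]distC => h.
  by apply: le_trans (lerD (ltW h) (le_trans pr hq)) _; lra.
have from_limit : U [set n | forall q, C q -> exists2 p, C' n p &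
    dist_inf R G S k q p <= e / 2].
  have [m' net] := @unit_cube_net R G S k _ e60.
  have [y Cy hy] := net C (Cset_unit_cube L1 mpL (k := k)) (Cset_nonempty lambda _ S k0).
  have one_point q : C q -> U [set n | exists2 p, C' n p & dist_inf R G S k q p <= e / 3].
    (* Three errors of [e / 9] add up to [e / 3]: realization by [f], twice [e / 18] for passing to
       coordinates, and the limit. *)
    have e180 : 0 < e / 18 by rewrite divr_gt0.
    have e360 : 0 < e / 36 by rewrite divr_gt0.
    have e90 : 0 < e / 9 by rewrite divr_gt0.
    move=> /(_ _ e90)[f [mf hf]].
    pose ev (i : label * G) (s : Omega) := s i.
    have [J [psi [mpsi hpsi]]] := meas_fin_approx L1 (ev := ev)
      (@measurable_coordinate G label) (@coordinate_generate G label) k0 mf e180.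
    have close := Mmat_close L1 mpL S mf mpsi hpsi.
    apply: filterS (Mmat_limit mp UU lim S J psi e90) => n /= h.
    exists (M' n (fun x => psi [seq trace a E n x i | i <- J])).
      apply: Mmat_Cset.
      exact: (fibre_measurable_sees J psi (ev := fun i x => trace a E n x i)
        (fun i => measurable_trace mp mE n i)).
    apply: le_trans (dist_triangle (ML f) _ _) _.
    apply: le_trans (lerD (ltW hf) (dist_triangle (ML (psi \o word J)) _ _)) _.
    by apply: le_trans (lerD (lexx _) (lerD close (ltW h))) _; lra.
  have near_net := filter_forall FU (fun r : 'I_m' => one_point _ (Cy r)).
  apply: filterS near_net => n near q /hy[r rm qr].
  have [p Cp yp] := near (Ordinal rm); exists p => //.
  by apply: le_trans (dist_triangle (y r) _ _) _; apply: le_trans (lerD qr yp) _; lra.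
apply: filterS2 into_limit from_limit => n h1 h2.
apply: le_lt_trans (_ : _ <= e / 2) _; last lra.
apply: hdist_le => //; [exact: Cset_nonempty|exact: Cset_nonempty].
Qed.

(** Equipartitions pass to the limit approximately, so every point of the limit space lies in pieces
    of arbitrarily small mass; thus the limit is atomless. *)
Lemma exists_limit_rep (A : nat -> cls R G) : (forall n, is_rep R G (A n) (P n) (a n)) ->
  exists2 A' : cls R G, Wspace R G A' & forall S k (e : R), (0 < k)%N -> 0 < e ->
    U [set n | hdist R G S k (A' S k) (A n S k) < e].
Proof.
move=> repA; have [P' [a' [mp' lim]]] := exists_limit_action.
exists (clsof R G _ R P' a') => [|S k e k0 e0]; last first.
  by apply: filterS (lim S k e k0 e0) => n /=; case: (repA n) => _ [_ ->].
exists P', a'; split=> //; split=> // x.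
have P1 := probability_setT P'; have mx : measurable [set x] := measurable_set1 x.
(* One [1/(k+1)] is the mass of a piece, the other two are the Hausdorff distance and the
   realization error. *)
suff small k : fine_measure P' [set x] <= 3 / k.+1%:R.
  apply/eqP; rewrite -(fine_measureK P1 mx) eqe eq_le fine_measure_ge0 andbT.
  apply/ler_addgt0Pr => e e0; rewrite add0r; apply: le_trans (small (Num.bound (3 / e))) _.
  have ge0 : 0 <= 3 / e by rewrite divr_ge0 // ltW.
  have := ltW (archi_boundP ge0); rewrite ler_pdivrMr // => h.
  by rewrite ler_pdivrMr //; apply: le_trans h _; rewrite mulrC ler_pM2l // ler_nat.
have k0 : 0 < k.+1%:R^-1 :> R by rewrite invr_gt0.
have [n hn] := filter_ex (lim [fset one]%fset k.+1 k.+1%:R^-1 isT k0).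
have [_ [atom _]] := repA n.
have [f mf hf] := atomless_equipartition atom (isT : (0 < k.+1)%N).
rewrite /= hdistC in hn.
have [p' Cp' hp'] := hdist_lt_exists (Cset_unit_cube (probability_setT (P n)) (mp n) (k := k.+1))
  (Cset_unit_cube P1 mp' (k := k.+1)) (Cset_nonempty P' a' _ (isT : (0 < k.+1)%N)) hn
  (Mmat_Cset (P n) (a n) _ mf).
have [u [mu hu]] := Cp' _ k0.
pose g1 : [fset one]%fset := FSetSub (fset11 (one : G)).
(* At the unit of [G], the diagonal entries are the masses of the pieces. *)
have diag (b : G -> R -> R) (Q : probability R R) (v : R -> 'I_k.+1) :
    is_mp_action R G _ R Q b ->
    Mmat R G _ R Q b [fset one]%fset k.+1 v g1 (u x) (u x) = fine_measure Q (v @^-1` [set u x]).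
  move=> mpb; rewrite /Mmat /fine_measure; congr (fine (Q _)).
  apply/seteqP; split=> y; first by case.
  by move=> h; split=> /=; rewrite ?mpb.1.1.
have := entry_le_dist (Mmat R G _ R (P n) (a n) [fset one]%fset k.+1 f) p' g1 (u x) (u x).
have := entry_le_dist p' (Mmat R G _ R P' a' [fset one]%fset k.+1 u) g1 (u x) (u x).
rewrite !diag // !ler_norml => /andP[l1 l2] /andP[l3 l4].
have l5 := hf (u x); have l6 : fine_measure P' [set x] <= fine_measure P' (u @^-1` [set u x]).
  by apply: (fine_measure_le P1) => // y ->.
move: (k.+1%:R^-1 : R) hp' hu l1 l3 l5 l6 => K.
move: (dist_inf _ _ _ _ _ p') (dist_inf _ _ _ _ p' _) => D1 D2.
move: (fine_measure _ [set x]) (fine_measure _ (u @^-1` _)) (fine_measure _ (f @^-1` _)).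
move: (p' _ _ _) => p X Y Z; lra.
Qed.

End LimitClass.

(** * The equivalence *)

Section Equivalence.
Context (R : realType) (G : groupType).
Variable C : set (cls R G * cls R G).

Let product_cube (P Q : probability R R) (a b : G -> R -> R) S k :
  is_mp_action R G _ R P a -> is_mp_action R G _ R Q b ->
  prodcls R G P Q a b S k `<=` @unit_cube R G S k.
Proof.
move=> mpa mpb; apply: Cset_unit_cube; last exact: prod_act_mp.
exact: product_probability_setT.
Qed.

(** A point of one product class is within [e / 4] of an [N]-step matrix, which transfers to the
    other pair at cost [e / 4]. Since [N] serves both pairs, the argument is symmetric. *)
Lemma uniform_step_bound_continuous :
  uniform_step_bound R G C -> prod_map_continuous R G C.
Proof.
move=> bound A B CAB S k k0 e e0; have e40 : 0 < e / 4 by rewrite divr_gt0.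
have [N [N0 hN]] := bound S k k0 _ e40.
have [r r0 transfer] := step_transfer S k N0 e40.
(* Only the matrices of the [N]-valued factor functions have to be close. *)
exists [:: (S, N)], r; split=> // A' B' CAB' nearA nearB P Q P' Q' a b a' b' rA rB rA' rB'.
have hA := nearA S N N0 (mem_head _ _); have hB := nearB S N N0 (mem_head _ _).
have approach (A1 B1 A2 B2 : cls R G) (P1 Q1 P2 Q2 : probability R R)
    (a1 b1 a2 b2 : G -> R -> R) : C (A1, B1) ->
    is_rep R G A1 P1 a1 -> is_rep R G B1 Q1 b1 ->
    is_rep R G A2 P2 a2 -> is_rep R G B2 Q2 b2 ->
    hdist R G S N (A1 S N) (A2 S N) < r -> hdist R G S N (B1 S N) (B2 S N) < r ->
    forall p, prodcls R G P1 Q1 a1 b1 S k p ->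
    exists2 q, prodcls R G P2 Q2 a2 b2 S k q & dist_inf R G S k p q <= e / 2.
  move=> C1 r1 s1 r2 s2 h1 h2 p Cp.
  have [N' [N'0 N'N approx]] := hN _ _ C1 _ _ _ _ r1 s1.
  have [h [/(step_fun_widen N'0 N'N) sh ph]] := approx p Cp.
  have [h' sh' hh'] := transfer _ _ _ _ _ _ _ _ _ _ _ _ r1 s1 r2 s2 h1 h2 h sh.
  exists (Mmat R G _ _ (P2 \x Q2)%E (prod_act G R R a2 b2) S k h').
    by apply: Mmat_Cset; exact: step_fun_meas_fin sh'.
  apply: le_trans (dist_triangle _ _ _) _; apply: le_trans (lerD (ltW ph) (ltW hh')) _.
  lra.
apply: le_lt_trans (_ : _ <= e / 2) _; last lra.
apply: hdist_le; [exact: Cset_nonempty|exact: Cset_nonempty| |].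
  exact: (approach _ _ _ _ _ _ _ _ _ _ _ _ CAB rA rB rA' rB' hA hB).
rewrite hdistC in hA; rewrite hdistC in hB => q Cq.
have [p Cp pq] := approach _ _ _ _ _ _ _ _ _ _ _ _ CAB' rA' rB' rA rB hA hB q Cq.
by exists p => //; rewrite distC.
Qed.

Lemma near_cls_filter (U : set_system nat) (A' : cls R G) (A : nat -> cls R G) L (r : R) :
  Filter U -> (forall S k, (0 < k)%N -> U [set n | hdist R G S k (A' S k) (A n S k) < r]) ->
  U [set n | near_cls R G L r A' (A n)].
Proof.
move=> FU h; elim: L => [|[S k] L IH]; first by apply: filterS filterT => n _ S k.
have [k0|k_gt0] := posnP k.
  apply: filterS IH => n nL S' k' k'0; rewrite in_cons => /orP[/eqP[_ E]|]; last exact: nL.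
  by rewrite E k0 in k'0.
apply: filterS2 (h S k k_gt0) IH => n hn nL S' k' k'0.
by rewrite in_cons => /orP[/eqP[-> ->] //|]; exact: nL.
Qed.

Hypothesis G_countable : countable [set: G].
Hypothesis C_closed : closed_WW R G C.

(** Otherwise pairs in [C] with N_{S,k} beyond every bound have a limit along [U], which lies in [C]
    because [C] is closed. The [N] of the limit pair at [e / 4] then works at [e] for [U]-many of
    them, a contradiction. *)
Lemma continuous_uniform_step_bound :
  prod_map_continuous R G C -> uniform_step_bound R G C.
Proof.
move=> cont S k k0 e e0; have e40 : 0 < e / 4 by rewrite divr_gt0.
apply: contrapT => unbounded.
pose bad n (t : (cls R G * cls R G) * (probability R R * probability R R) *
    ((G -> R -> R) * (G -> R -> R))) :=
  [/\ C t.1.1, is_rep R G t.1.1.1 t.1.2.1 t.2.1, is_rep R G t.1.1.2 t.1.2.2 t.2.2 &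
      ~ Nsk_le R G t.1.2.1 t.1.2.2 t.2.1 t.2.2 S k e n.+1].
have /choice[t ht] : forall n, exists t, bad n t.
  move=> n; apply: contrapT => none; apply: unbounded; exists n.+1; split=> //.
  move=> A B CAB P Q a b rA rB; apply: contrapT => nN; apply: none.
  by exists ((A, B), (P, Q), (a, b)).
pose A n := (t n).1.1.1; pose B n := (t n).1.1.2.
pose P n := (t n).1.2.1; pose Q n := (t n).1.2.2; pose a n := (t n).2.1; pose b n := (t n).2.2.
have CAB n : C (A n, B n) by have [] := ht n; rewrite /A /B; case: (t n) => -[[]].
have rA n : is_rep R G (A n) (P n) (a n) by have [] := ht n.
have rB n : is_rep R G (B n) (Q n) (b n) by have [] := ht n.
have nN n : ~ Nsk_le R G (P n) (Q n) (a n) (b n) S k e n.+1 by have [] := ht n.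
(* [U] refines the filter at infinity, so it contains every set of indices [n >= N]. *)
have [U [UU sub]] := @ultraFilterLemma nat \oo _.
have FU : Filter U by exact: filter_filter.
have [A' WA' limA] := exists_limit_rep G_countable (fun n => (rA n).1) UU rA.
have [B' WB' limB] := exists_limit_rep G_countable (fun n => (rB n).1) UU rB.
have near L (r : R) : 0 < r ->
    U [set n | near_cls R G L r A' (A n) /\ near_cls R G L r B' (B n)].
  move=> r0; apply: filterI; apply: near_cls_filter => S' k' k'0.
    exact: limA.
  exact: limB.
have CAB' : C (A', B').
  apply: contrapT => nC; have [L [r [r0 far]]] := C_closed.2 _ _ WA' WB' nC.
  have [n nn] := filter_ex (near L r r0).
  exact: far (CAB n) nn.
have [[P' [a' rA']] [Q' [b' rB']]] := (WA', WB').
have [N N0 approx] := exists_step_approx rA'.1 rB'.1 S k0 e40.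
have [r r0 transfer] := step_transfer S k N0 e40.
have [L [s [s0 hcont]]] := cont _ _ CAB' S k k0 _ e40.
have [n [Nn [nA nB] hA hB]] : exists n, [/\ (N <= n)%N,
    near_cls R G L s A' (A n) /\ near_cls R G L s B' (B n),
    hdist R G S N (A' S N) (A n S N) < r & hdist R G S N (B' S N) (B n S N) < r].
  have UN : U [set n | (N <= n)%N] by apply: sub; exists N.
  have [n [[h1 h2] [h3 h4]]] := filter_ex (filterI (filterI UN (near L s s0))
    (filterI (limA S N r N0 r0) (limB S N r N0 r0))).
  by exists n; split.
apply: (nN n); exists N; split=> //; first exact: leq_trans Nn _.
move=> p Cp.
have hd := hcont _ _ (CAB n) nA nB _ _ _ _ _ _ _ _ rA' rB' (rA n) (rB n).
rewrite hdistC in hd.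
have [q Cq pq] := hdist_lt_exists (product_cube (rA n).1 (rB n).1)
  (product_cube rA'.1 rB'.1) (Cset_nonempty _ _ _ k0) hd Cp.
have [h [sh qh]] := approx q Cq.
have [h' sh' hh'] := transfer _ _ _ _ _ _ _ _ _ _ _ _ rA' rB' (rA n) (rB n) hA hB h sh.
exists h'; split=> //.
(* Continuity, approximation at the limit pair and transfer cost [e / 4] each. *)
apply: le_lt_trans (dist_triangle q _ _) _.
apply: le_lt_trans (lerD (ltW pq) (dist_triangle _ _ _)) _.
by apply: le_lt_trans (lerD (lexx _) (lerD (ltW qh) (ltW hh'))) _; lra.
Qed.

End Equivalence.

Unset Implicit Arguments.
Set Strict Implicit.

Theorem theorem4p2 (R : realType) (G : groupType)
    (G_countable : countable [set: G]) (G_infinite : infinite_set [set: G])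
    (C : set (cls R G * cls R G)) (HC : closed_WW R G C) :
  prod_map_continuous R G C <-> uniform_step_bound R G C.
Proof.
split; first exact: continuous_uniform_step_bound.
exact: uniform_step_bound_continuous.
Qed.
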